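(* Let $(\tau_n)_{n\in\mathbb{N}}$ be the Thue–Morse sequence and $\tau(t)=\sum_{n=1}^\infty\tau_nt^{-n}\in\mathbb{F}_2(\!(t^{-1})\!)$. Then $\tau(t)$ exhibits full generic escape of mass with respect to $\{t^k\}_{k\ge0}$; that is, for every $\varepsilon>0$, $\lim_{n\to\infty}d(\{k\in\mathbb{N}:e_{k,n}(\tau(t))>1-\varepsilon\})=1$.
   Context: The Thue–Morse sequence over $\mathbb{F}_2$ is the fixed point $0110100110010110\cdots$ of the substitution $0\mapsto01$, $1\mapsto10$; $\tau(t)$ is a quadratic irrational. For a quadratic irrational $\Theta$, $e_{k,n}(\Theta):=\frac{\sum_{i=1}^{\ell_{k}}\max\{\deg A_i^{[\Theta t^k]}-n,0\}}{\sum_{i=1}^{\ell_{k}}\deg A_i^{[\Theta t^k]}}$, where $\ell_k$ is the period length of the eventually periodic continued fraction of $\Theta\cdot t^k$ and $A_1^{[\Theta t^k]},\dots,A_{\ell_k}^{[\Theta t^k]}$ are the partial quotients of one period. For $A\subseteq\mathbb{N}$, $d(A)=\lim_{m\to\infty}\frac{|A\cap\{1,\dots,m\}|}{m}$. *)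

(* Defs.v *)
From HB Require Import structures.
From mathcomp Require Import all_boot all_order all_algebra.
From mathcomp Require Import all_classical all_reals all_analysis.
Set Implicit Arguments. Unset Strict Implicit. Unset Printing Implicit Defensive.
Import Order.TTheory GRing.Theory Num.Theory.
Import numFieldNormedType.Exports.
Local Open Scope classical_set_scope.
Local Open Scope ring_scope.

Definition tm_subst (w : seq bool) : seq bool :=
  flatten [seq [:: b; ~~ b] | b <- w].
(* sigma^m(0), a word of length 2^m which is a prefix of the fixed point. *)
Definition tm_word (m : nat) : seq bool := iter m tm_subst [:: false].
(* tau_n = n-th letter of the fixed point 0110100110010110...  (n < 2^n). *)
Definition thue_morse (n : nat) : bool := nth false (tm_word n) n.

(* A formal series  sum_n x(n) t^n ; the Laurent series are those with
   x(n) = 0 for all large n (see [ls_bounded]). *)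
Definition ls := int -> 'F_2.

Definition ls_bounded (x : ls) : Prop :=
  exists N : int, forall n : int, N < n -> x n = 0.

(* tau(t) = sum_{n >= 1} tau_n t^{-n} : coefficient of t^{-(m+1)} is tau_{m+1}. *)
Definition tau_series : ls :=
  fun j => match j with Negz m => (thue_morse m.+1 : nat)%:R | Posz _ => 0 end.

Definition ls_mul_tpow (x : ls) (k : nat) : ls := fun j => x (j - k%:Z).

Definition ls_frac (x : ls) : ls := fun j => if j < 0 then x j else 0.

Definition is_polypart (x : ls) (A : {poly 'F_2}) : Prop :=
  forall n : nat, x n%:Z = A`_n.

Definition nat_trunc (z : int) : nat :=
  match z with Posz m => m | Negz _ => 0%N end.

(* Coefficient of t^n of the product x*y, when both x and y vanish above
   degree N: the sum of x(i) y(n-i) over the (finitely many) i with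
   i <= N and n - i <= N, i.e. i = n - N + k, 0 <= k <= 2N - n. *)
Definition ls_mul_coef (N : int) (x y : ls) (n : int) : 'F_2 :=
  \sum_(k < nat_trunc (2 * N - n + 1)) x (n - N + k%:Z) * y (N - k%:Z).

Definition ls_inverse (x y : ls) : Prop :=
  exists N : int, (forall n : int, N < n -> x n = 0 /\ y n = 0) /\
    forall n : int, ls_mul_coef N x y n = (n == 0)%:R.

Definition cf_expansion (x : ls) (A : nat -> {poly 'F_2}) : Prop :=
  exists X : nat -> ls, X 0%N = x /\
    forall i : nat, is_polypart (X i) (A i) /\ ls_inverse (ls_frac (X i)) (X i.+1).

Definition cf_period (x : ls) (A : nat -> {poly 'F_2}) (i0 l : nat) : Prop :=
  cf_expansion x A /\ (0 < l)%N /\ forall i : nat, (i0 <= i)%N -> A (i + l)%N = A i.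

Definition pdeg (p : {poly 'F_2}) : nat := (size p).-1.

Definition escape_ratio (R : realType) (A : nat -> {poly 'F_2}) (i0 l n : nat) : R :=
  ((\sum_(j < l) (pdeg (A (i0 + j)%N) - n)%N)%:R) /
  ((\sum_(j < l) pdeg (A (i0 + j)%N))%:R).

Definition escape_set (R : realType) (Theta : ls) (n : nat) (eps : R) (k : nat) : Prop :=
  exists (A : nat -> {poly 'F_2}) (i0 l : nat),
    cf_period (ls_mul_tpow Theta k) A i0 l /\ 1 - eps < escape_ratio R A i0 l n.

Definition density_ratio (R : realType) (S : nat -> Prop) (m : nat) : R :=
  (\sum_(1 <= k < m.+1) (`[< S k >] : nat))%:R / m%:R.

Definition has_density (R : realType) (S : nat -> Prop) (dS : R) : Prop :=
  density_ratio R S m @[m --> \oo] --> dS.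

(* Main.v *)
Require Import Defs.
From HB Require Import structures.
From mathcomp Require Import all_boot all_order all_algebra.
From mathcomp Require Import all_classical all_reals all_analysis.
From mathcomp Require Import ring zify.
Import Order.TTheory GRing.Theory Num.Theory.
Import numFieldNormedType.Exports.
Local Open Scope classical_set_scope.
Local Open Scope ring_scope.

(* Write [t = z + 1 + z^-1].  Then [tau_n] is the sum modulo 2 of the coefficients of
   the positive powers of [z] in [t^n], and the quadratic field generated by [tau(t)] is
   [F2(z)], with [z -> z^-1] as conjugation and [1 + z + z^2 = z t].  A number [n] is not
   the degree of a convergent denominator of [t^k tau(t)] as soon as some nonzero [q] of
   degree [< n] satisfies [|| q t^k tau || < 2^-n] (the pair [(k, n)] is then singular).
   Through [z], such [q] come from Pade approximations [A + z^N B = 0 mod (1+z+z^2)^M];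
   raising one of them to the power [2^r] gives a singular zone of size about [2^r] around
   a point of the [(k, n)] plane, and a pigeonhole in the field with four elements shows
   that for [M] odd one of any three consecutive exponents [N] starting at an even number
   does have such an approximation.  Hence every aligned square of side [16 w], [w] a power
   of [16], contains a fully singular square of side [w], so a square of side [16^h] has at
   most [255^h] nonsingular points.  As the degrees of the convergent denominators are
   nonsingular, the number of partial quotients per unit of degree tends to [0] outside a
   set of [k] of density [0], and for the remaining [k] all but a proportion [eps] of the
   degree of a period sits in large partial quotients.  Here the density equals [1] for
   every [n], not just in the limit. *)

(** * Pade approximations modulo powers of 1 + X + X^2 *)

Notation F2 := 'F_2.

Lemma char2_poly : 1 + 1 = 0 :> {poly F2}.
Proof. by rewrite -polyCD; have -> : 1 + 1 = 0 :> F2 by apply/val_inj. Qed.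

Lemma char2_poly3 : 3%:R = 1 :> {poly F2}.
Proof. by rewrite mulrS [2%:R]char2_poly addr0. Qed.

Lemma char2_poly4 : 4%:R = 0 :> {poly F2}.
Proof. by rewrite (natrM _ 2 2) [2%:R]char2_poly mul0r. Qed.

(* The [ring] tactic only cancels the multiples of [2] it is told about. *)
Ltac ring2 := ring: char2_poly3 char2_poly4 char2_poly.

Lemma addpp (p : {poly F2}) : p + p = 0.
Proof. by rewrite -{1}[p]mulr1 -{2}[p]mulr1 -mulrDr char2_poly mulr0. Qed.

Lemma addpC_eq (p q : {poly F2}) : p + q = 0 -> p = q.
Proof. by move=> e; rewrite -[p]addr0 -(addpp q) addrA e add0r. Qed.

Lemma F2_cases (x : F2) : x = 0 \/ x = 1.
Proof.
by case: x => [[|[|x]] lt_x2]; [left | right | ]; try exact: val_inj.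
Qed.

Definition Pi : {poly F2} := 'X^2 + 'X + 1.

Lemma size_Pi : size Pi = 3%N.
Proof.
by rewrite /Pi -addrA size_polyDl size_polyXn // (size_polyDl (p := 'X)) size_polyX // size_poly1.
Qed.

Lemma Pi_neq0 : Pi != 0.
Proof. by rewrite -size_poly_gt0 size_Pi. Qed.

Lemma size_PiX n : size (Pi ^+ n) = n.*2.+1.
Proof.
have := size_exp Pi n; rewrite size_Pi /= mul2n => <-.
by rewrite prednK // size_poly_gt0 expf_neq0 // Pi_neq0.
Qed.

Lemma size2_cases (r : {poly F2}) : (size r <= 2)%N ->
  [\/ r = 0, r = 1, r = 'X | r = 'X + 1].
Proof.
move=> sz_r; have -> : r = r`_1 *: 'X + (r`_0)%:P.
  apply/polyP => -[|[|i]]; rewrite coefD coefZ coefX coefC /= ?mulr0 ?add0r ?mulr1 ?addr0 //.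
  by rewrite nth_default //; exact: leq_trans sz_r _.
case: (F2_cases r`_1) => ->; case: (F2_cases r`_0) => ->;
 rewrite ?scale0r ?scale1r ?add0r ?polyC0 ?addr0.
- by constructor 1.
- by constructor 2.
- by constructor 3.
- by constructor 4.
Qed.

(* [F2[X]/Pi] is the field with four elements, whose units are 1, X, X^2. *)
Lemma Pi_dvd_cases (U V : {poly F2}) :
  [\/ Pi %| U, Pi %| V, Pi %| U + V | Pi %| U + 'X * V \/ Pi %| U + 'X^2 * V].
Proof.
have dvd_mod (W K : {poly F2}) :
    U %% Pi + W * (V %% Pi) = K * Pi -> Pi %| U + W * V.
  move=> dv; apply/dvdpP; exists (U %/ Pi + W * (V %/ Pi) + K).
  rewrite {1}(divp_eq U Pi) {1}(divp_eq V Pi) [RHS]mulrDl -dv; ring.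
have szm (W : {poly F2}) : (size (W %% Pi)%R <= 2)%N.
  by rewrite -ltnS -size_Pi ltn_modp Pi_neq0.
case: (size2_cases _ (szm U)) => eU; first by constructor 1; apply/eqP.
all: case: (size2_cases _ (szm V)) => eV; first by constructor 2; apply/eqP.
all: rewrite eU eV /Pi in dvd_mod.
- by constructor 3; rewrite -[V]mul1r; apply: (dvd_mod 1 0); ring2.
- by constructor 4; right; apply: (dvd_mod 'X^2 ('X + 1)); ring2.
- by constructor 4; left; apply: (dvd_mod 'X 1); ring2.
- by constructor 4; left; apply: (dvd_mod 'X 0); ring2.
- by constructor 3; rewrite -[V]mul1r; apply: (dvd_mod 1 0); ring2.
- by constructor 4; right; apply: (dvd_mod 'X^2 'X); rewrite ?eV; ring2.
- by constructor 4; right; apply: (dvd_mod 'X^2 1); ring2.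
- by constructor 4; left; apply: (dvd_mod 'X 1); ring2.
- by constructor 3; rewrite -[V]mul1r; apply: (dvd_mod 1 0); ring2.
Qed.

(** Linear algebra: the [a + b] coefficients of [A] and [B] meet only [d] linear conditions, the
    coefficients of the residue modulo [P]. *)
Lemma pade_exists (P W : {poly F2}) (d a b : nat) :
  size P = d.+1 -> (d < a + b)%N ->
  exists A B : {poly F2}, [/\ (A != 0) || (B != 0), (size A <= a)%N, (size B <= b)%N
    & P %| A + W * B].
Proof.
move=> sP dab.
have P0 : P != 0 by rewrite -size_poly_gt0 sP.
pose g (v : 'rV[F2]_(a + b)) := rVpoly (lsubmx v) + W * rVpoly (rsubmx v).
have gZD c : {morph g : u v / c *: u + v}.
  by move=> u v; rewrite /g !linearP /= mulrDr scalerDr scalerAr addrACA.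
pose f (v : 'rV[F2]_(a + b)) : 'rV_d := poly_rV (g v %% P).
have f_lin : linear f.
  by move=> c u v; rewrite /f gZD modpD modpZl !linearP.
pose fL : {linear 'rV[F2]_(a + b) -> 'rV[F2]_d} :=
  HB.pack f (GRing.isLinear.Build _ _ _ _ f f_lin).
have : kermx (lin1_mx fL) != 0.
  rewrite -mxrank_eq0 mxrank_ker -lt0n subn_gt0.
  by apply: leq_ltn_trans dab; exact: rank_leq_col.
case/rowV0Pn => v /sub_kermxP; rewrite mul_rV_lin1 => fv v0.
exists (rVpoly (lsubmx v)), (rVpoly (rsubmx v)); split; rewrite ?size_poly //.
- apply: contraR v0; rewrite negb_or !negbK => /andP[/eqP eA /eqP eB].
  rewrite -[v]hsubmxK -[lsubmx v]rVpolyK -[rsubmx v]rVpolyK eA eB.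
  by rewrite !linear0 row_mx0.
- have /(congr1 rVpoly) : f v = 0 by [].
  rewrite poly_rV_K ?linear0; first by move=> e; apply/eqP.
  by rewrite -ltnS -sP ltn_modpN0.
Qed.

Lemma sqr_addp (p q : {poly F2}) : (p + q) ^+ 2 = p ^+ 2 + q ^+ 2.
Proof. ring2. Qed.

Lemma sqr_inj (p q : {poly F2}) : p ^+ 2 = q ^+ 2 -> p = q.
Proof.
move=> e; apply: addpC_eq; apply/eqP.
by have := expf_eq0 (p + q) 2; rewrite sqr_addp e addpp eqxx /= => <-.
Qed.

Lemma size_sqr_leq (p : {poly F2}) n : (size p <= n.+1)%N -> (size (p ^+ 2) <= n.*2.+1)%N.
Proof.
move=> sp; have := size_poly_exp_leq p 2; move=> /leq_trans-> //.
by rewrite muln2 ltnS leq_double; case: (size p) sp.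
Qed.

(** Nonzero terms cannot cancel: one has even degree, the other odd degree. *)
Lemma sqrD_Xsqr_eq0 (p q : {poly F2}) : p ^+ 2 + 'X * q ^+ 2 = 0 -> (p == 0) && (q == 0).
Proof.
move=> /addpC_eq e.
have [q0|q0] := eqVneq q 0.
  by move: e; rewrite q0 expr0n mulr0 => /eqP; rewrite expf_eq0 /= => ->.
have := congr1 (fun r : {poly F2} => size r) e.
have [p0|p0] := eqVneq p 0.
  move=> _; move/eqP: e.
  by rewrite p0 expr0n /= eq_sym mulf_eq0 expf_eq0 polyX_eq0 (negbTE q0).
rewrite mulrC size_mulX ?expf_neq0 // => se.
have := size_exp p 2; have := size_exp q 2; rewrite se.
have : (0 < size p)%N by rewrite size_poly_gt0.
have : (0 < size q)%N by rewrite size_poly_gt0.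
have : (0 < size (q ^+ 2))%N by rewrite size_poly_gt0 expf_neq0.
move: (size p) (size q) (size (q^+2)) => x y z.
by lia.
Qed.

(* The residues of the squares of two Pade approximants of order [m] and of their
   multiples by [X] and [X^2] are proportional in the field with four elements;
   whichever of the three possible ratios occurs kills one of the exponents. *)
Lemma pade_odd_singular (m n : nat) : exists (i : nat) (A B : {poly F2}),
  [/\ (i <= 2)%N, (A != 0) || (B != 0), (size A <= m.*2.+1)%N, (size B <= m.*2.+1)%N
    & Pi ^+ m.*2.+1 %| A + 'X^(n.*2 + i) * B].
Proof.
(* The size bounds [m.+1, m] and [m, m.+1] are unequal on purpose: after squaring, [b] and [a'] have
   room for a factor ['X] or ['X^2]. *)
have [|a [b [ab0 sa sb /dvdpP[C eC]]]] := @pade_exists (Pi ^+ m) 'X^(n.+1) m.*2 m.+1 m (size_PiX m).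
  by rewrite addSn addnn.
have [|a' [b' [ab'0 sa' sb' /dvdpP[C' eC']]]] := @pade_exists (Pi ^+ m) 'X^n m.*2 m m.+1 (size_PiX m).
  by rewrite addnS addnn.
have e2 : a ^+ 2 + 'X^(n.*2.+2) * b ^+ 2 = C ^+ 2 * Pi ^+ m.*2.
  rewrite (_ : n.*2.+2 = n.+1 * 2)%N; last by lia.
  by rewrite -[m.*2]muln2 !exprM -!exprMn -sqr_addp eC.
have e2' : a' ^+ 2 + 'X^(n.*2) * b' ^+ 2 = C' ^+ 2 * Pi ^+ m.*2.
  by rewrite -[m.*2]muln2 -[n.*2]muln2 !exprM -!exprMn -sqr_addp eC'.
have ss (p : {poly F2}) : (size p <= m.+1)%N -> (size (p ^+ 2) <= m.*2.+1)%N.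
  exact: size_sqr_leq.
have sQ (Q p : {poly F2}) : (size Q <= 3)%N -> (size p <= m)%N ->
    (size (Q * p ^+ 2)%R <= m.*2.+1)%N.
  case: m {eC eC' e2 e2' ss sa sb sa' sb'} => [|k] sQ sp.
    by move: sp; rewrite leqn0 size_poly_eq0 => /eqP->; rewrite expr0n mulr0 size_poly0.
  have := size_sqr_leq _ _ sp; have := size_polyMleq Q (p ^+ 2); lia.
have sD (p q : {poly F2}) k : (size p <= k)%N -> (size q <= k)%N -> (size (p + q)%R <= k)%N.
  by move=> sp sq; apply: leq_trans (size_polyD _ _) _; rewrite geq_max sp.
have dvS (W V : {poly F2}): Pi %| V -> W = V * Pi ^+ m.*2 -> Pi ^+ m.*2.+1 %| W.
  by move=> /dvdpP[K ->] ->; rewrite -mulrA -exprS dvdp_mulIr.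
have sPi : (size Pi <= 3)%N by rewrite size_Pi.
have sX : (size ('X : {poly F2}) <= 3)%N by rewrite size_polyX.
have sX2 : (size ('X^2 : {poly F2}) <= 3)%N by rewrite size_polyXn.
have ssl (p : {poly F2}) : (size p <= m)%N -> (size (p ^+ 2) <= m.*2.+1)%N.
  by move=> sp; apply: ss; exact: leqW.
case: (Pi_dvd_cases (C ^+ 2) (C' ^+ 2)) => [dC|dC|dC|[] dC].
- exists 2%N, (a ^+ 2), (b ^+ 2); split => //; try exact: ss; try exact: ssl.
  + by rewrite !expf_eq0 /=.
  + by apply: (dvS _ _ dC); rewrite addn2.
- exists 0%N, (a' ^+ 2), (b' ^+ 2); split => //; try exact: ss; try exact: ssl.
  + by rewrite !expf_eq0 /=.
  + by apply: (dvS _ _ dC); rewrite addn0.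
(* The combination may vanish identically. Then [a = a'], so [a] and [b] both have size at most [m],
   and there is room to multiply the squared approximation by [Pi] instead. *)
- have [e0|ne0] := boolP ((a ^+ 2 + a' ^+ 2 == 0) && ('X^2 * b ^+ 2 + b' ^+ 2 == 0)).
    have [/eqP/addpC_eq/sqr_inj ea /eqP/addpC_eq eb] := andP e0.
    exists 2%N, (Pi * a ^+ 2), (Pi * b ^+ 2); split => //; try (apply: sQ => //; by rewrite ea).
      by move: ab0; rewrite !(mulf_eq0 Pi) (negbTE Pi_neq0) /= !(expf_eq0 _ 2).
    apply: (dvS _ (Pi * C ^+ 2)); first exact: dvdp_mulIl.
    by rewrite -mulrA -e2 addn2; move: ('X^_) => Z; ring.
  exists 0%N, (a ^+ 2 + a' ^+ 2), ('X^2 * b ^+ 2 + b' ^+ 2); split => //.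
  + by rewrite -negb_and.
  + by apply: sD; try exact: ss; exact: ssl.
  + by apply: sD; try exact: ss; try exact: ssl; exact: sQ.
  + apply: (dvS _ _ dC); rewrite mulrDl -e2 -e2' addn0 !exprS; move: ('X^(n.*2)) => Z; ring.
- exists 1%N, (a ^+ 2 + 'X * a' ^+ 2), (b' ^+ 2 + 'X * b ^+ 2); split => //.
  + rewrite -negb_and; apply/negP => /andP[/eqP/sqrD_Xsqr_eq0/andP[a0 _]].
    move=> /eqP/sqrD_Xsqr_eq0/andP[_ b0].
    by move: ab0; rewrite a0 b0.
  + by apply: sD; try exact: ss; try exact: ssl; exact: sQ.
  + by apply: sD; try exact: ss; try exact: ssl; exact: sQ.
  + apply: (dvS _ _ dC); rewrite mulrDl -(mulrA 'X) -e2 -e2' addn1 !exprS;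
      move: ('X^(n.*2)) => Z; ring.
- have [e0|ne0] := boolP ((a ^+ 2 + 'X^2 * a' ^+ 2 == 0) && (b ^+ 2 + b' ^+ 2 == 0)).
    have [/eqP/addpC_eq ea /eqP/addpC_eq/sqr_inj eb] := andP e0.
    exists 0%N, (Pi * a' ^+ 2), (Pi * b' ^+ 2); split => //; try (apply: sQ => //;
      by rewrite -eb).
      by move: ab'0; rewrite !(mulf_eq0 Pi) (negbTE Pi_neq0) /= !(expf_eq0 _ 2).
    apply: (dvS _ (Pi * C' ^+ 2)); first exact: dvdp_mulIl.
    by rewrite -mulrA -e2' addn0; move: ('X^_) => Z; ring.
  exists 2%N, (a ^+ 2 + 'X^2 * a' ^+ 2), (b ^+ 2 + b' ^+ 2); split => //.
  + by rewrite -negb_and.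
  + by apply: sD; try exact: ss; try exact: ssl; exact: sQ.
  + by apply: sD; try exact: ss; exact: ssl.
  + apply: (dvS _ _ dC); rewrite mulrDl -(mulrA 'X^2) -e2 -e2' addn2 !exprS;
      move: ('X^(n.*2)) => Z; ring.
Qed.

(** * Symmetric Laurent polynomials *)

Section LinearExtension.
Variable V : lmodType F2.
Implicit Types (f g : nat -> V) (p q : {poly F2}).

Definition lext f p : V := \sum_(i < size p) p`_i *: f i.

Lemma lextE n f p : (size p <= n)%N -> lext f p = \sum_(i < n) p`_i *: f i.
Proof.
move=> sp; rewrite /lext (big_ord_widen n (fun i => p`_i *: f i)) // big_mkcond /=.
apply: eq_bigr => i _; case: ltnP => // le_pi.
by rewrite nth_default // scale0r.
Qed.

Lemma lext_is_linear f : linear (lext f).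
Proof.
move=> c p q; set n := maxn (size p) (size q).
have sp : (size p <= n)%N by rewrite leq_maxl.
have sq : (size q <= n)%N by rewrite leq_maxr.
have spq : (size (c *: p + q)%R <= n)%N.
  apply: leq_trans (size_polyD _ _) _; rewrite geq_max sq andbT.
  exact: leq_trans (size_scale_leq _ _) sp.
rewrite (lextE _ f _ sp) (lextE _ f _ sq) (lextE _ f _ spq).
rewrite scaler_sumr -big_split /=; apply: eq_bigr => i _.
by rewrite coefD coefZ scalerDl scalerA.
Qed.

HB.instance Definition _ f :=
  GRing.isLinear.Build F2 {poly F2} V *:%R (lext f) (lext_is_linear f).

Lemma lextXn f n : lext f 'X^n = f n.
Proof.
rewrite /lext size_polyXn big_ord_recr /= coefXn eqxx scale1r big1 ?add0r // => i _.
by rewrite coefXn (ltn_eqF (ltn_ord i)) scale0r.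
Qed.

Lemma lext_mulX f p : lext f ('X * p) = lext (fun i => f i.+1) p.
Proof.
have sXp : (size ('X * p)%R <= (size p).+1)%N.
  by apply: leq_trans (size_polyMleq _ _) _; rewrite size_polyX.
rewrite (lextE _ f _ sXp) big_ord_recl coefXM /= scale0r add0r.
by apply: eq_bigr => i _; rewrite coefXM.
Qed.

Lemma lextD f g p : lext f p + lext g p = lext (fun i => f i + g i) p.
Proof. by rewrite -big_split; apply: eq_bigr => i _; rewrite scalerDr. Qed.

Lemma eq_lext f g p : f =1 g -> lext f p = lext g p.
Proof. by move=> fg; apply: eq_bigr => i _; rewrite fg. Qed.

End LinearExtension.
Arguments lext {V}.
Arguments lextE {V} n.

(** * Frobenius and reciprocal polynomials *)

Lemma sqr_polyE (p : {poly F2}) : p ^+ 2 = \sum_(i < size p) p`_i *: 'X^(i.*2).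
Proof.
rewrite -{1}[p]coefK poly_def (big_morph (fun q => q ^+ 2) sqr_addp (expr0n _ _)).
apply: eq_bigr => i _; rewrite exprZn -exprM muln2; congr (_ *: _).
by case: (F2_cases p`_i) => ->; rewrite ?expr0n ?expr1n.
Qed.

Lemma exp2n_addp (p q : {poly F2}) r :
  (p + q) ^+ (2 ^ r) = p ^+ (2 ^ r) + q ^+ (2 ^ r).
Proof. by elim: r => [|r IH]; rewrite ?expn0 ?expr1 // expnSr !exprM IH sqr_addp. Qed.

(** This is [X^n p(1/X)], taken with respect to a degree bound [n] rather than the actual degree,
    which keeps it linear in [p]. *)
Definition revp (n : nat) (p : {poly F2}) : {poly F2} := \poly_(i < n.+1) p`_(n - i).

Lemma coef_rev n (p : {poly F2}) i : (revp n p)`_i = if (i <= n)%N then p`_(n - i) else 0.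
Proof. by rewrite coef_poly ltnS. Qed.

Lemma size_rev n (p : {poly F2}) : (size (revp n p) <= n.+1)%N.
Proof. exact: size_poly. Qed.

Lemma revK n (p : {poly F2}) : (size p <= n.+1)%N -> revp n (revp n p) = p.
Proof.
move=> sp; apply/polyP => i; rewrite !coef_rev leq_subr.
case: leqP => [le_in|lt_ni]; first by rewrite subKn.
by rewrite nth_default // (leq_trans sp).
Qed.

Lemma rev_is_linear n : linear (revp n).
Proof.
move=> c p q; apply/polyP => i; rewrite coefD coefZ !coef_rev.
by case: leqP => _; rewrite ?coefD ?coefZ // mulr0 addr0.
Qed.

HB.instance Definition _ n :=
  GRing.isLinear.Build F2 {poly F2} {poly F2} *:%R (revp n) (rev_is_linear n).

Lemma rev_Xn n i : (i <= n)%N -> revp n 'X^i = 'X^(n - i).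
Proof.
move=> le_in; apply/polyP => j; rewrite coef_rev !coefXn.
case: leqP => [le_jn|lt_nj]; last by case: eqP => // ?; lia.
by congr ((_ : bool)%:R); apply/eqP/eqP; lia.
Qed.

Lemma revE n (p : {poly F2}) : (size p <= n.+1)%N ->
  revp n p = \sum_(i < size p) p`_i *: 'X^(n - i).
Proof.
move=> sp; rewrite -{1}[p]coefK poly_def linear_sum; apply: eq_bigr => i _.
by rewrite linearZ /= rev_Xn // -ltnS (leq_trans (ltn_ord i)).
Qed.

Lemma revM m n (p q : {poly F2}) : (size p <= m.+1)%N -> (size q <= n.+1)%N ->
  revp (m + n) (p * q) = revp m p * revp n q.
Proof.
move=> sp sq; rewrite (revE m p) // (revE n q) // -{1}[p]coefK -{1}[q]coefK !poly_def.
rewrite !mulr_suml linear_sum; apply: eq_bigr => i _.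
rewrite !mulr_sumr linear_sum; apply: eq_bigr => j _.
have le_im : (i <= m)%N by rewrite -ltnS (leq_trans (ltn_ord i)).
have le_jn : (j <= n)%N by rewrite -ltnS (leq_trans (ltn_ord j)).
rewrite -!scalerAl -!scalerAr -!exprD !linearZ /= rev_Xn ?leq_add //.
by rewrite !scalerA [q`_j * _]mulrC addnBA // addnBAC // subnDA.
Qed.

Lemma rev_addn n m (p : {poly F2}) : (size p <= n.+1)%N -> revp (n + m) p = revp n p * 'X^m.
Proof.
move=> sp; rewrite -{1}[p]mulr1 revM ?size_poly1 //.
by rewrite -(expr0 'X) rev_Xn // subn0.
Qed.

Lemma rev_exp m (p : {poly F2}) e : (size p <= m.+1)%N ->
  revp (m * e) (p ^+ e) = revp m p ^+ e.
Proof.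
move=> sp; elim: e => [|e IH]; first by rewrite muln0 !expr0 -{1}(expr0 'X) rev_Xn.
rewrite mulnS !exprS revM ?IH //.
by apply: leq_trans (size_poly_exp_leq _ _) _; rewrite ltnS leq_mul2r;
  case: (size p) sp => [|k] /=; lia.
Qed.

(* [dickson n] is [z^n + z^-n] for [X = z + 1 + z^-1]. *)
Fixpoint dickson (n : nat) : {poly F2} :=
  if n is n1.+1 then
    if n1 is n2.+1 then ('X + 1) * dickson n1 + dickson n2 else 'X + 1
  else 0.

Lemma dicksonSS n : dickson n.+2 = ('X + 1) * dickson n.+1 + dickson n.
Proof. by []. Qed.

Lemma size_XD1 : size ('X + 1 : {poly F2}) = 2%N.
Proof. by rewrite size_polyDl ?size_polyX ?size_poly1. Qed.

Lemma size_dickson n : size (dickson n.+1) = n.+2.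
Proof.
elim/ltn_ind: n => -[_|[_|n IH]]; first exact: size_XD1.
  rewrite dicksonSS addr0 size_mul ?size_XD1 // -size_poly_gt0 ?size_XD1 //=.
have s2 : size (('X + 1) * dickson n.+2)%R = n.+4.
  rewrite size_mul -?size_poly_gt0 ?size_XD1 ?IH //.
by rewrite dicksonSS size_polyDl s2 // IH // ltnW.
Qed.

Definition dicksonz (z : int) : {poly F2} := dickson `|z|%N.

Lemma dicksonzN z : dicksonz (- z) = dicksonz z.
Proof. by rewrite /dicksonz abszN. Qed.

Lemma dicksonz_rec z :
  dicksonz (z + 1) + dicksonz (z - 1) = ('X + 1) * dicksonz z.
Proof.
wlog z0 : z / 0 <= z.
  move=> W; case: (lerP 0 z) => [/W //|lt_z0].
  rewrite -(dicksonzN z) -W; last by lia.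
  by rewrite addrC -(dicksonzN (z - 1)) -(dicksonzN (z + 1)); congr (dicksonz _ + dicksonz _);
    lia.
case: z z0 => // -[|n] _.
  by rewrite /dicksonz /= mulr0 addpp.
rewrite /dicksonz (_ : absz (n.+1%:Z + 1) = n.+2); last by lia.
rewrite (_ : absz (n.+1%:Z - 1) = n); last by lia.
by rewrite dicksonSS -addrA addpp addr0.
Qed.

(* The symmetrisation of [z^-c * p(z)]. *)
Definition trz (c : int) (p : {poly F2}) : {poly F2} :=
  lext (fun i => dicksonz (i%:Z - c)) p.

HB.instance Definition _ c :=
  GRing.isLinear.Build F2 {poly F2} {poly F2} *:%R (trz c) (lext_is_linear _ _).

Lemma trz_mulX c (p : {poly F2}) : trz c ('X * p) = trz (c - 1) p.
Proof. by rewrite /trz lext_mulX; apply: eq_lext => i; congr (dicksonz _); lia. Qed.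

Lemma trz_mulXn c n (p : {poly F2}) : trz c ('X^n * p) = trz (c - n%:Z) p.
Proof.
elim: n c => [|n IH] c; first by rewrite mul1r subr0.
by rewrite exprS -mulrA trz_mulX IH; congr (trz _ _); lia.
Qed.

(** [Pi(z) = z t], and [t] is invariant under [z -> z^-1]: it leaves the symmetrisation as ['X],
    while the factor [z] moves the centre by one. *)
Lemma trz_mulPi c (p : {poly F2}) : trz c (Pi * p) = 'X * trz (c - 1) p.
Proof.
rewrite /Pi !mulrDl mul1r !linearD /= trz_mulXn trz_mulX.
have e : trz (c - 2%:Z) p + trz c p = ('X + 1) * trz (c - 1) p.
  rewrite /trz lextD /lext mulr_sumr; apply: eq_bigr => i _.
  rewrite -scalerAr -dicksonz_rec; congr (_ *: (dicksonz _ + dicksonz _)); lia.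
by rewrite addrAC e mulrDl mul1r -addrA addpp addr0.
Qed.

Lemma trz_mulPiX c n (p : {poly F2}) : trz c (Pi ^+ n * p) = 'X^n * trz (c - n%:Z) p.
Proof.
elim: n c => [|n IH] c; first by rewrite !mul1r subr0.
by rewrite !exprS -!mulrA trz_mulPi IH; congr (_ * (_ * trz _ _)); lia.
Qed.

Lemma trz_rev c n (p : {poly F2}) : (size p <= n.+1)%N -> trz c (revp n p) = trz (n%:Z - c) p.
Proof.
move=> sp; rewrite /trz (lextE n.+1) ?size_rev // (lextE n.+1) //.
rewrite (reindex_inj rev_ord_inj) /=; apply: eq_bigr => i _.
have le_in : (i <= n)%N by rewrite -ltnS.
rewrite coef_rev subSS leq_subr subKn // -dicksonzN; congr (_ *: dicksonz _); lia.
Qed.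

Lemma trz0E (p : {poly F2}) : trz 0 p = \sum_(i < size p) p`_i *: dickson i.
Proof. by apply: eq_bigr => i _; rewrite subr0. Qed.

Lemma size_trz0_leq (p : {poly F2}) : (size (trz 0 p) <= size p)%N.
Proof.
rewrite trz0E; apply: leq_trans (size_sum _ _ _) _.
apply/bigmax_leqP => i _; apply: leq_trans (size_scale_leq _ _) _.
by case: i => -[|i] /=; rewrite ?size_poly0 // size_dickson.
Qed.

(** The Dickson polynomial of highest index dominates in degree. Constants must be excluded because
    [dickson 0 = 0]. *)
Lemma trz0_neq0 (p : {poly F2}) : p`_0 = 0 -> p != 0 -> trz 0 p != 0.
Proof.
move=> p0 pn0; have := pn0; rewrite -size_poly_gt0 trz0E.
case sp: (size p) => [|[|n]] // _.
  by case/eqP: pn0; rewrite [p]size1_polyC ?sp // p0.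
rewrite big_ord_recr /= -size_poly_gt0 addrC size_polyDl.
  rewrite size_scale ?size_dickson // -[n.+1]/(n.+2.-1) -sp -lead_coefE lead_coef_eq0 //.
rewrite size_scale ?size_dickson;
  last by rewrite -[n.+1]/(n.+2.-1) -sp -lead_coefE lead_coef_eq0.
rewrite ltnS; apply: leq_trans (size_sum _ _ _) _.
apply/bigmax_leqP => i _; apply: leq_trans (size_scale_leq _ _) _.
by case: i => -[|i] /=; rewrite ?size_poly0 // size_dickson.
Qed.

(** * Singular points of the number wall of the Thue-Morse sequence *)

Lemma size_tm_subst w : size (tm_subst w) = (size w).*2.
Proof. by elim: w => //= b w IH; rewrite /tm_subst /= -/(tm_subst w) IH. Qed.

Lemma nth_tm_subst w n : (n < size w)%N ->
  nth false (tm_subst w) n.*2 = nth false w n /\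
  nth false (tm_subst w) n.*2.+1 = ~~ nth false w n.
Proof. by elim: w n => // b w IH [|n] // lt_nw; exact: IH. Qed.

Lemma size_tm_word m : size (tm_word m) = (2 ^ m)%N.
Proof. by elim: m => // m IH; rewrite /tm_word iterS size_tm_subst IH expnS mul2n. Qed.

Lemma nth_tm_wordS m n : (n < 2 ^ m)%N ->
  nth false (tm_word m.+1) n = nth false (tm_word m) n.
Proof.
elim: m n => [|m IH] n; first by case: n.
move=> lt_nm; have lt_n2 : (n./2 < 2 ^ m)%N by rewrite ltn_half_double -mul2n -expnS.
have lt_n2' : (n./2 < 2 ^ m.+1)%N by apply: leq_trans lt_n2 _; rewrite leq_exp2l.
have [e1 o1] : nth false (tm_word m.+2) n./2.*2 = nth false (tm_word m.+1) n./2 /\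
    nth false (tm_word m.+2) n./2.*2.+1 = ~~ nth false (tm_word m.+1) n./2.
  by apply: (nth_tm_subst (tm_word m.+1)); rewrite size_tm_word.
have [e2 o2] : nth false (tm_word m.+1) n./2.*2 = nth false (tm_word m) n./2 /\
    nth false (tm_word m.+1) n./2.*2.+1 = ~~ nth false (tm_word m) n./2.
  by apply: (nth_tm_subst (tm_word m)); rewrite size_tm_word.
by rewrite -[n]odd_double_half; case: odd; rewrite ?add1n ?add0n ?e1 ?o1 ?e2 ?o2 IH.
Qed.

Lemma nth_tm_word m n : (n < 2 ^ m)%N -> nth false (tm_word m) n = thue_morse n.
Proof.
have add_word k l : (n < 2 ^ k)%N -> nth false (tm_word (k + l)) n = nth false (tm_word k) n.
  move=> lt_nk; elim: l => [|l IH]; first by rewrite addn0.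
  by rewrite addnS nth_tm_wordS // (leq_trans lt_nk) // leq_exp2l // leq_addr.
move=> lt_nm; rewrite -(add_word m n lt_nm) addnC add_word //.
exact: ltn_expl.
Qed.

Definition tau (n : nat) : F2 := (thue_morse n : nat)%:R.

Lemma tau_doubles n : tau n.*2 = tau n /\ tau n.*2.+1 = tau n + 1.
Proof.
have lt_n : (n < size (tm_word n))%N by rewrite size_tm_word ltn_expl.
have lt_n2 : (n.*2.+1 < 2 ^ n.+1)%N.
  by rewrite expnS mul2n -doubleS leq_double ltn_expl.
have [e o] : nth false (tm_word n.+1) n.*2 = nth false (tm_word n) n /\
    nth false (tm_word n.+1) n.*2.+1 = ~~ nth false (tm_word n) n := nth_tm_subst _ _ lt_n.
rewrite nth_tm_word ?(ltnW lt_n2) // in e; rewrite nth_tm_word // in o.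
rewrite /tau e o; split=> //; rewrite -/(thue_morse n).
by case: thue_morse; apply/val_inj.
Qed.

Lemma tau_double n : tau n.*2 = tau n. Proof. by case: (tau_doubles n). Qed.

Lemma tau_doubleS n : tau n.*2.+1 = tau n + 1. Proof. by case: (tau_doubles n). Qed.

Lemma tau0 : tau 0 = 0. Proof. exact/val_inj. Qed.

(** * The linear functional attached to the Thue-Morse sequence *)

Arguments dickson : simpl never.

(** The coefficient of [t^0] in [p(t) tau(t)], as [tau 0 = 0]. *)
Definition Lam (p : {poly F2}) : F2^o := lext (tau : nat -> F2^o) p.

HB.instance Definition _ :=
  GRing.isLinear.Build F2 {poly F2} F2^o *:%R Lam (lext_is_linear _ _).

Lemma addF2 (x : F2) : x + x = 0.
Proof. by case: (F2_cases x) => ->; apply/val_inj. Qed.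

Lemma Lam_sqr p : Lam (p ^+ 2) = Lam p.
Proof.
rewrite sqr_polyE linear_sum /=; apply: eq_bigr => i _.
by rewrite linearZ /= [Lam _]lextXn tau_double.
Qed.

Lemma Lam_mulX_sqr p : Lam ('X * p ^+ 2) = Lam p + p.[1].
Proof.
rewrite sqr_polyE mulr_sumr linear_sum horner_coef /Lam /lext -big_split /=.
apply: eq_bigr => i _; rewrite -scalerAr -exprS linearZ /= [Lam _]lextXn tau_doubleS.
by rewrite scalerDr expr1n.
Qed.

(** A quadratic form preserved by the recurrence, hence equal to its value at [n = 0]; it yields the
    doubling formulas below. *)
Lemma dickson_norm n :
  dickson n.+1 ^+ 2 + ('X + 1) * dickson n * dickson n.+1 + dickson n ^+ 2 = ('X + 1) ^+ 2.
Proof.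
elim: n => [|n IH]; first by rewrite [dickson 0]/(0 : {poly F2}) mulr0 mul0r expr0n !addr0.
rewrite -IH dicksonSS; ring2.
Qed.

Lemma dickson_doubles n :
  dickson n.*2 = dickson n ^+ 2 /\ dickson n.*2.+1 = dickson n * dickson n.+1 + ('X + 1).
Proof.
elim: n => [|n [e o]]; first by rewrite [dickson 0]/(0 : {poly F2}) expr0n mul0r add0r.
have e' : dickson n.+1.*2 = dickson n.+1 ^+ 2.
  rewrite doubleS dicksonSS e o; have := dickson_norm n => nm.
  apply: addpC_eq; rewrite -(addpp (('X + 1) ^+ 2)) -{1}nm.
  ring2.
split=> //; rewrite doubleS (dicksonSS n.*2.+1) -doubleS e' o dicksonSS. ring2.
Qed.

Lemma dickson_at1 n : (dickson n).[1] = 0.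
Proof.
suff: (dickson n).[1] = 0 /\ (dickson n.+1).[1] = 0 by case.
elim: n => [|n [e o]]; first by rewrite horner0 hornerD hornerX hornerC addF2.
by split=> //; rewrite dicksonSS hornerD hornerM o e mulr0 addr0.
Qed.

(** With [Lam 1 = 0], this makes [Lam] the sum of the coefficients of the positive powers of [z].
    Even indices reduce by Frobenius; for odd ones the term [('X + 1) * dickson m ^+ 2] contributes
    [(dickson m).[1] = 0]. *)
Lemma Lam_dickson n : Lam (dickson n.+1) = 1.
Proof.
elim/ltn_ind: n => -[_|n IH].
  by rewrite linearD /= -['X]expr1 -(expr0 'X) ![Lam _]lextXn; apply/val_inj.
have := odd_double_half n.+2; case: odd; case: half => [|m] // e; rewrite -e; move: e;
  rewrite ?add1n ?add0n => e.
  rewrite doubleS dicksonSS -doubleS (dickson_doubles _).1 linearD /= IH; last by lia.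
  by rewrite mulrDl mul1r linearD /= Lam_mulX_sqr Lam_sqr dickson_at1 addr0 addF2 add0r.
rewrite (dickson_doubles _).1 Lam_sqr IH //; lia.
Qed.

(** [('X + 1) * dickson j = dickson j.+1 + dickson j.-1], on which [Lam] is [1 + 1 = 0]; each factor
    ['X] moves the indices by at most one, so they stay positive. *)
Lemma Lam_Xn_dickson i j : (i.+2 <= j)%N -> Lam ('X^i * (('X + 1) * dickson j)) = 0.
Proof.
elim: i j => [|i IH] [|[|j]] // le_ij.
  rewrite mul1r (_ : ('X + 1) * dickson j.+2 = dickson j.+3 + dickson j.+1).
    by rewrite linearD /= !Lam_dickson addF2.
  by rewrite (dicksonSS j.+1) -addrA addpp addr0.
have -> : 'X^(i.+1) * (('X + 1) * dickson j.+2) =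
    'X^i * (('X + 1) * dickson j.+3) + 'X^i * (('X + 1) * dickson j.+2)
      + 'X^i * (('X + 1) * dickson j.+1).
  rewrite (dicksonSS j.+1) exprS. ring2.
by rewrite !linearD /= !IH ?addr0 //; lia.
Qed.

Lemma Lam_Xn_trz0 i b (p : {poly F2}) : (forall j, (j < b)%N -> p`_j = 0) -> (i.+2 <= b)%N ->
  Lam ('X^i * (('X + 1) * trz 0 p)) = 0.
Proof.
move=> p_b le_ib; rewrite trz0E !mulr_sumr linear_sum big1 //= => j _.
case: (ltnP j b) => [/p_b ->|le_bj]; first by rewrite scale0r !mulr0 linear0.
by rewrite -!scalerAr linearZ /= Lam_Xn_dickson ?scaler0 // (leq_trans le_ib).
Qed.

(** Raise the approximation to the power [e] and centre it at [z^a]. The terms from [A] then sit at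
    exponents [-a] to [-(b + 2)] and are reflected; those from [B] start at [b]. So no exponent of
    absolute value below [b] remains. *)
Lemma Xn_dvd_trz0 (A B : {poly F2}) (r n M N a b : nat) (e := (2 ^ r)%N) :
  (size A <= n.+1)%N -> Pi ^+ M %| A + 'X^N * B ->
  (a + b = N * e)%N -> (a = b + n * e + 2)%N ->
  'X^(M * e) %| trz 0 ('X^b * ('X^2 * revp n A ^+ e + B ^+ e)).
Proof.
move=> sA /dvdpP[C eC] eab ea.
have sAe : (size (revp n A ^+ e) <= (n * e).+1)%N.
  apply: leq_trans (size_poly_exp_leq _ _) _; rewrite ltnS leq_mul2r.
  by have := size_rev n A; case: size => [|k] /=; lia.
have eA : revp (n * e) (revp n A ^+ e) = A ^+ e by rewrite rev_exp ?size_rev // revK.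
have eP : A ^+ e + 'X^(a + b) * B ^+ e = Pi ^+ (M * e) * C ^+ e.
  by rewrite eab !exprM -!exprMn -exp2n_addp eC mulrC.
have -> : trz 0 ('X^b * ('X^2 * revp n A ^+ e + B ^+ e)) =
    trz a (A ^+ e + 'X^(a + b) * B ^+ e).
  rewrite mulrDr mulrA -exprD !linearD /= -eA trz_rev // !trz_mulXn.
  by congr (trz _ _ + trz _ _); lia.
by rewrite eP trz_mulPiX dvdp_mulIl.
Qed.

(* [singular k n] states that the [n]-th Hankel determinant of [t^k tau(t)] vanishes. *)
Definition singular (k n : nat) := exists q : {poly F2},
  [/\ q != 0, (size q <= n)%N & forall i, (i < n)%N -> Lam ('X^(k.+1 + i) * q) = 0].

(** The witness is [('X + 1) * Q] with [trz 0 P = Q * 'X^(M * e)], [M = 2u + 1] and [e = 8w]; the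
    column [w * (16 * u + 8)] is [M * e]. The index [i] is the one supplied by
    [pade_odd_singular]. *)
Lemma singular_porous h u v (w := (16 ^ h)%N) : exists2 i, (i <= 2)%N &
  forall x y, (x < w)%N -> (y < w)%N ->
    singular (w * (16 * u + 8) + x) (w * (16 * v + 4 * i.+1) + y).
Proof.
have [i [A [B [i2 AB0 sA sB dv]]]] := pade_odd_singular u (2 * v + u + 1).
exists i => // x y lt_x lt_y.
have w0 : (0 < w)%N by rewrite expn_gt0.
pose e := (2 ^ (4 * h + 3))%N.
have ee : e = (8 * w)%N by rewrite /e expnD expnM mulnC.
(* [b] solves [a + b = N * e] and [a = b + 2 u e + 2] for [N = 2 (2v + u + 1) + i]; this choice of
   [N] makes [u] cancel. *)
pose b := (4 * w * (4 * v + i + 2) - 1)%N.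
pose a := (b + u.*2 * e + 2)%N.
pose P := 'X^b * ('X^2 * revp u.*2 A ^+ e + B ^+ e).
have eab : (a + b = ((2 * v + u + 1).*2 + i) * e)%N by rewrite /a /b ee; nia.
have /dvdpP[Q eQ] := Xn_dvd_trz0 A B (4 * h + 3) _ _ _ a b sA dv eab erefl.
rewrite -/e -/P in eQ; clearbody e; clearbody w.
have e0 : (0 < e)%N by rewrite ee; lia.
have szE (p : {poly F2}) : p != 0 -> size (p ^+ e) = ((size p).-1 * e).+1.
  move=> p0; rewrite -size_exp prednK // size_poly_gt0 expf_neq0 //.
have P0 : P != 0.
  rewrite mulf_neq0 ?expf_neq0 ?polyX_eq0 //; apply/eqP => /addpC_eq eP.
  have := congr1 (fun p : {poly F2} => size p) eP.
  have [rA0|rA0] := eqVneq (revp u.*2 A) 0.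
    have A0 : A = 0 by rewrite -(revK _ _ sA) rA0 linear0.
    move: AB0 eP;
      rewrite A0 eqxx /= linear0 expr0n -[e == 0%N]leqn0 leqNgt e0 mulr0 => B0 /esym/eqP.
    by rewrite expf_eq0 (negbTE B0) andbF.
  have [B0|B0] := eqVneq B 0.
    move: eP; rewrite B0 expr0n -[e == 0%N]leqn0 leqNgt e0 => /eqP.
    by rewrite mulf_eq0 !expf_eq0 polyX_eq0 (negbTE rA0) !andbF.
  (* The two degrees are congruent to [2] and [0] modulo [e >= 8], hence distinct. *)
  rewrite mulrC size_mulXn ?expf_neq0 // !szE // ee; nia.
have Pb j : (j < b)%N -> P`_j = 0 by move=> lt_jb; rewrite coefXnM lt_jb.
have sP : (size P <= a.+1)%N.
  rewrite /P mulrC; apply: leq_trans (size_polyMleq _ _) _; rewrite size_polyXn.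
  have sR : (size ('X^2 * revp u.*2 A ^+ e + B ^+ e)%R <= (u.*2 * e).+3)%N.
    apply: leq_trans (size_polyD _ _) _; rewrite geq_max; apply/andP; split.
      apply: leq_trans (size_polyMleq _ _) _; rewrite size_polyXn /= !ltnS.
      apply: leq_trans (size_poly_exp_leq _ _) _; rewrite ltnS leq_mul2r.
      by have := size_rev u.*2 A; case: size => [|k] /=; lia.
    apply: leq_trans (size_poly_exp_leq _ _) _; apply: leqW; apply: leqW.
    by rewrite ltnS leq_mul2r; case: size sB => [|k] /=; lia.
  by rewrite /a; lia.
have T0 : trz 0 P != 0 by apply: trz0_neq0 => //; apply: Pb; rewrite /b; nia.
have Q0 : Q != 0 by apply: contraNneq T0 => Q0; rewrite eQ Q0 mul0r.
have sQ : (size Q + u.*2.+1 * e <= a.+1)%N.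
  apply: leq_trans sP; apply: leq_trans (size_trz0_leq _).
  by rewrite eQ size_mulXn // addnC.
exists (('X + 1) * Q); split.
- by rewrite mulf_neq0 // -size_poly_gt0 size_XD1.
- have -> : size (('X + 1) * Q) = (size Q).+1.
    by rewrite size_mul ?size_XD1 // -size_poly_gt0 size_XD1.
  have sQ' : (size Q + u.*2.+1 * (8 * w) <= (4 * w * (4 * v + i + 2) - 1 + u.*2 * (8 * w) + 2).+1)%N
    by rewrite -ee.
  have eu : (u.*2.+1 * (8 * w) = u.*2 * (8 * w) + 8 * w)%N by rewrite mulSn addnC.
  have ew : (4 * w * (4 * v + i + 2) = w * (16 * v + 4 * i.+1) + 4 * w)%N by ring.
  have w1 : (0 < w * (16 * v + 4 * i.+1) + 4 * w)%N by lia.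
  rewrite eu ew in sQ'.
  set K := (w * (16 * v + 4 * i.+1))%N in sQ' w1 *.
  set U := (u.*2 * (8 * w))%N in sQ'.
  clearbody K U.
  lia.
- move=> l lt_l.
  have -> : 'X^((w * (16 * u + 8) + x).+1 + l) * (('X + 1) * Q) =
      'X^(x + 1 + l) * (('X + 1) * trz 0 P).
    rewrite eQ (_ : (_ + l = x + 1 + l + u.*2.+1 * e)%N); last by rewrite ee; nia.
    by rewrite exprD; ring.
  apply: Lam_Xn_trz0 Pb _; rewrite /b; nia.
Qed.

(** * Counting nonsingular points *)

Section RegularCount.
Local Open Scope nat_scope.

Definition regular (k n : nat) : bool := ~~ `[< singular k n >].

Definition regular_count (k X : nat) : nat := \sum_(n < X) regular k n.

Lemma sum_ord_mul (F : nat -> nat) a b :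
  (\sum_(i < a * b) F i = \sum_(i < a) \sum_(j < b) F (b * i + j))%N.
Proof.
elim: a => [|a IH]; first by rewrite mul0n !big_ord0.
by rewrite mulSn addnC big_split_ord /= IH big_ord_recr /= mulnC.
Qed.

(** Among the [256] subsquares, [singular_porous] empties one and the induction hypothesis bounds
    the others. *)
Lemma regular_box h u v :
  (\sum_(x < 16 ^ h) \sum_(y < 16 ^ h) regular (16 ^ h * u + x) (16 ^ h * v + y)
     <= 255 ^ h)%N.
Proof.
elim: h u v => [|h IH] u v; first by rewrite !big_ord1 leq_b1.
set w := (16 ^ h)%N; have -> : (16 ^ h.+1 = 16 * w)%N by rewrite expnS.
pose box x y : nat := \sum_(x' < w) \sum_(y' < w)
  regular (w * (16 * u + x) + x') (w * (16 * v + y) + y').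
rewrite (sum_ord_mul (fun x => \sum_(y < 16 * w) regular (16 * w * u + x) (16 * w * v + y))).
under eq_bigr => x _.
  under eq_bigr => x' _.
    rewrite (sum_ord_mul (fun y => regular (16 * w * u + (w * x + x')) (16 * w * v + y)))%N.
    over.
  rewrite exchange_big /=.
  rewrite (eq_bigr (fun y : 'I_16 => box x y)); last first.
    move=> y _; apply: eq_bigr => x' _; apply: eq_bigr => y' _.
    by congr (nat_of_bool (regular _ _)); ring.
  over.
rewrite pair_bigA /=.
have [i i2 sing] := singular_porous h u v; rewrite -/w in sing.
have lt_i : (4 * i.+1 < 16)%N by lia.
rewrite (bigD1 (Ordinal (isT : 8 < 16)%N, Ordinal lt_i)) //=.
rewrite (_ : box _ _ = 0%N); last first.
  apply: big1 => x' _; apply: big1 => y' _; rewrite /regular.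
  by have /asboolP -> := sing x' y' (ltn_ord x') (ltn_ord y').
rewrite add0n;
  apply: (@leq_trans (\sum_(p : 'I_16 * 'I_16 | p != (Ordinal (isT : 8 < 16)%N, Ordinal lt_i)) 255 ^ h)%N).
  by apply: leq_sum => p _; exact: IH.
rewrite sum_nat_const expnS leq_mul2r; apply/orP; right.
by rewrite cardC1 card_prod !card_ord.
Qed.

Lemma regular_block h u V :
  (\sum_(x < 16 ^ h) regular_count (16 ^ h * u + x) (V * 16 ^ h) <= V * 255 ^ h)%N.
Proof.
rewrite /regular_count.
under eq_bigr => x _.
  rewrite (sum_ord_mul (fun y => regular (16 ^ h * u + x) y))%N.
  over.
rewrite exchange_big /= (_ : V * 255 ^ h = \sum_(v < V) 255 ^ h); last first.
  by rewrite sum_nat_const card_ord.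
by apply: leq_sum => v _; exact: regular_box.
Qed.

Lemma eventually_ltn (P : nat -> nat -> Prop) n :
  (forall x, exists X0, forall X, (X0 <= X)%N -> P x X) ->
  exists X0, forall x X, (x < n)%N -> (X0 <= X)%N -> P x X.
Proof.
move=> evP; elim: n => [|n [X1 IH]]; first by exists 0%N.
have [X2 P2] := evP n; exists (maxn X1 X2) => x X.
rewrite ltnS leq_eqVlt geq_max => /predU1P[->|lt_xn] /andP[le1 le2]; first exact: P2.
exact: IH.
Qed.

(** The finitely many columns of the block share a height [X0.+1 * w] at which each bad one has its
    many regular points; compare with [regular_block] and cancel [X0.+1]. *)
Lemma dense_columns_block (bad : nat -> bool) (c h u : nat) :
  (forall k, bad k -> exists X0, forall X, (X0 <= X)%N -> (X <= c * regular_count k X)%N) ->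
  (\sum_(x < 16 ^ h) bad (16 ^ h * u + x) * 16 ^ h <= c * 255 ^ h)%N.
Proof.
move=> bad_dense; set w := (16 ^ h)%N.
have w0 : (0 < w)%N by rewrite expn_gt0.
have [|X0 dense] := eventually_ltn
    (fun x X => bad (w * u + x)%N -> (X <= c * regular_count (w * u + x) X)%N) w.
  move=> x; case: (boolP (bad (w * u + x)%N)) => [/bad_dense[X0 X0P]|_]; last by exists 0%N.
  by exists X0 => X /X0P.
rewrite -(leq_pmul2l (ltn0Sn X0)).
apply: (@leq_trans (c * \sum_(x < w) regular_count (w * u + x) (X0.+1 * w))); last first.
  by rewrite mulnCA leq_mul2l regular_block orbT.
rewrite !big_distrr /=; apply: leq_sum => x _.
case: (boolP (bad _)) => [bx|_]; last by rewrite mul0n muln0.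
by rewrite mul1n; apply: dense => //; rewrite (leq_trans (leqnSn X0)) // leq_pmulr.
Qed.

(** Blocks of width [16 ^ h] cover the range. Divided by [m * 16 ^ h], the bound gives upper density
    at most [c * (255 / 256) ^ h]. *)
Lemma dense_columns_count (bad : nat -> bool) (c h m : nat) :
  (forall k, bad k -> exists X0, forall X, (X0 <= X)%N -> (X <= c * regular_count k X)%N) ->
  (\sum_(1 <= k < m.+1) bad k * 16 ^ h <= (m %/ 16 ^ h).+1 * (c * 255 ^ h))%N.
Proof.
move=> bad_dense; set w := (16 ^ h)%N.
have w0 : (0 < w)%N by rewrite expn_gt0.
have lt_m : (m < (m %/ w).+1 * w)%N by rewrite ltn_ceil.
apply: (@leq_trans (\sum_(k < (m %/ w).+1 * w) bad k * w)%N).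
  rewrite -big_distrl -[X in (_ <= X)%N]big_distrl /= leq_mul2r; apply/orP; right.
  rewrite -(big_mkord xpredT (fun k => nat_of_bool (bad k))) [X in (_ <= X)%N](big_cat_nat (n := 1%N)) //=; last exact: leq_trans (ltn0Sn m) lt_m.
  rewrite [X in (_ <= _ + X)%N](big_cat_nat (n := m.+1)) //=.
  by rewrite addnCA leq_addr.
rewrite (sum_ord_mul (fun k => bad k * w)).
rewrite (_ : (m %/ w).+1 * _ = \sum_(u < (m %/ w).+1) c * 255 ^ h); last first.
  by rewrite sum_nat_const card_ord.
by apply: leq_sum => u _; exact: dense_columns_block.
Qed.

End RegularCount.

(** * Power series and continued fractions over F2 *)

(** Series in [t^-1], under a name of their own so that the ring product is convolution. *)
Definition pser : Type := nat -> F2.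

Implicit Types f g h u : pser.

HB.instance Definition _ := GRing.Zmodule.copy pser (nat -> F2).

Definition pser_one : pser := fun n => (n == 0%N)%:R.
Definition pser_mul (f g : pser) : pser := fun n => \sum_(i < n.+1) f i * g (n - i)%N.
Definition pser_trunc n (f : pser) : {poly F2} := \poly_(i < n.+1) f i.

Lemma coef_trunc n f i : (i <= n)%N -> (pser_trunc n f)`_i = f i.
Proof. by move=> le_in; rewrite coef_poly ltnS le_in. Qed.

Lemma pser_mul_trunc m n f g : (n <= m)%N ->
  pser_mul f g n = (pser_trunc m f * pser_trunc m g)`_n.
Proof.
move=> le_nm; rewrite coefM; apply: eq_bigr => i _.
have le_in : (i <= n)%N by rewrite -ltnS.
by rewrite !coef_trunc ?(leq_trans le_in) // (leq_trans (leq_subr _ _)).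
Qed.

Lemma pser_mulC : commutative pser_mul.
Proof.
by move=> f g; apply/funext => n; rewrite !(pser_mul_trunc n n) // mulrC.
Qed.

Lemma pser_mulA : associative pser_mul.
Proof.
have mulE f g h n : pser_mul (pser_mul f g) h n =
    (pser_trunc n f * pser_trunc n g * pser_trunc n h)`_n.
  rewrite coefM; apply: eq_bigr => i _; have le_in : (i <= n)%N by rewrite -ltnS.
  by rewrite (pser_mul_trunc n) // coef_trunc // leq_subr.
move=> f g h; apply/funext => n.
by rewrite pser_mulC !mulE mulrC mulrA.
Qed.

Lemma pser_mul1 : left_id pser_one pser_mul.
Proof.
move=> f; apply/funext => n; rewrite /pser_mul big_ord_recl subn0 mul1r big1 ?addr0 // => i _.
by rewrite mul0r.
Qed.

Lemma pser_mulD : left_distributive pser_mul +%R.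
Proof.
move=> f g h; apply/funext => n.
rewrite -[RHS]/(pser_mul f h n + pser_mul g h n) /pser_mul -big_split /=.
by apply: eq_bigr => i _; rewrite -mulrDl.
Qed.

Lemma pser_one_neq0 : pser_one != 0.
Proof. by apply/eqP => /(congr1 (fun f : pser => f 0%N)). Qed.

HB.instance Definition _ := GRing.Zmodule_isComNzRing.Build pser
  pser_mulA pser_mulC pser_mul1 pser_mulD pser_one_neq0.

Lemma coef_psD (f g : pser) n : (f + g) n = f n + g n. Proof. by []. Qed.

Lemma coef_ps0 n : (0 : pser) n = 0. Proof. by []. Qed.

Lemma coef_psM (f g : pser) n : (f * g) n = \sum_(i < n.+1) f i * g (n - i)%N.
Proof. by []. Qed.

Lemma coef_psM0 (f g : pser) : (f * g) 0%N = f 0%N * g 0%N.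
Proof. by rewrite coef_psM big_ord1. Qed.

Lemma addss (f : pser) : f + f = 0.
Proof. by apply/funext => n; rewrite coef_psD addF2. Qed.

Lemma char2_pser : 1 + 1 = 0 :> pser. Proof. exact: addss. Qed.

Lemma char2_pser3 : 3%:R = 1 :> pser.
Proof. by rewrite mulrS [2%:R]char2_pser addr0. Qed.

Lemma char2_pser4 : 4%:R = 0 :> pser.
Proof. by rewrite (natrM _ 2 2) [2%:R]char2_pser mul0r. Qed.

Ltac psring2 := ring: char2_pser3 char2_pser4 char2_pser.

Lemma addsC_eq (f g : pser) : f + g = 0 -> f = g.
Proof. by move=> e; rewrite -[f]addr0 -(addss g) addrA e add0r. Qed.

(** The variable of [p] is read as [t^-1], so a polynomial in [t] of degree at most [D] enters as
    [ofp (revp D p)], that is, divided by [t^D]. *)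
Definition ofp (p : {poly F2}) : pser := fun i => p`_i.

Lemma ofpD p q : ofp (p + q) = ofp p + ofp q.
Proof. by apply/funext => n; rewrite /ofp coefD. Qed.

Lemma ofpM p q : ofp (p * q) = ofp p * ofp q.
Proof. by apply/funext => n; rewrite /ofp coefM. Qed.

Lemma ofp0 : ofp 0 = 0. Proof. by apply/funext => n; rewrite /ofp coef0. Qed.

Lemma ofp1 : ofp 1 = 1. Proof. by apply/funext => n; rewrite /ofp coef1. Qed.

Lemma ofp_exp p n : ofp (p ^+ n) = ofp p ^+ n.
Proof. by elim: n => [|n IH]; rewrite ?expr0 ?ofp1 // !exprS ofpM IH. Qed.

Lemma coef_psXnM n (f : pser) i :
  (ofp 'X^n * f) i = if (i < n)%N then 0 else f (i - n)%N.
Proof.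
rewrite coef_psM (eq_bigr (fun j : 'I_i.+1 => ('X^n)`_j * (pser_trunc i f)`_(i - j))).
  rewrite -coefM coefXnM; case: ltnP => // le_ni.
  by rewrite coef_trunc // leq_subr.
by move=> j _; rewrite coef_trunc // leq_subr.
Qed.

Definition eqps n (f g : pser) := forall i, (i < n)%N -> f i = g i.

Lemma eqps_mull n (f g h : pser) : eqps n f g -> eqps n (h * f) (h * g).
Proof.
move=> fg i lt_in; rewrite !coef_psM; apply: eq_bigr => j _.
by rewrite fg // (leq_ltn_trans (leq_subr _ _)).
Qed.

Lemma eqps_mul_small n (u f : pser) : u 0%N = 0 -> eqps n f 0 -> eqps n.+1 (u * f) 0.
Proof.
move=> u0 f0 i lt_in; rewrite coef_psM big1 // => -[[|j] lt_j] _ /=; first by rewrite u0 mul0r.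
by rewrite f0 ?coef_ps0 ?mulr0 //; lia.
Qed.

Lemma eqpsD n (f f' g g' : pser) : eqps n f f' -> eqps n g g' -> eqps n (f + g) (f' + g').
Proof. by move=> ff gg i lt_in; rewrite !coef_psD ff ?gg. Qed.

Lemma eqps_sub n (f g : pser) : eqps n f g <-> eqps n (f + g) 0.
Proof.
split=> fg i lt_in; first by rewrite coef_psD fg // addF2.
have := fg i lt_in; rewrite coef_psD => e.
by rewrite -[LHS]addr0 -(addF2 (g i)) addrA e add0r.
Qed.

(** * Quadratic equations over power series: the root without constant term *)

Section SmallRoot.
Variables a b c : pser.
Hypotheses (b0 : b 0%N = 1) (c0 : c 0%N = 0).

Let Phi (f : pser) := c + a * f ^+ 2 + (1 + b) * f.

(** The difference is [f + g] times [a (f + g) + (1 + b)], which has no constant term, so one more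
    coefficient agrees. *)
Lemma Phi_contract n f g : f 0%N = 0 -> g 0%N = 0 -> eqps n f g -> eqps n.+1 (Phi f) (Phi g).
Proof.
move=> f0 g0 /eqps_sub fg; apply/eqps_sub.
have -> : Phi f + Phi g = (a * (f + g)) * (f + g) + (1 + b) * (f + g).
  rewrite /Phi; psring2.
rewrite -[0]addr0; apply: eqpsD; apply: eqps_mul_small => //.
  by rewrite coef_psM0 coef_psD f0 g0 addr0 mulr0.
by rewrite coef_psD b0 -[(1 : pser) 0%N]/1 addF2.
Qed.

Lemma Phi0 f : f 0%N = 0 -> Phi f 0%N = 0.
Proof. by move=> f0; rewrite /Phi !coef_psD expr2 !coef_psM0 f0 c0 !mulr0 !addr0. Qed.

Lemma small_root_fix f : b * f = c + a * f ^+ 2 -> f = Phi f.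
Proof. by move=> e; rewrite /Phi -e; psring2. Qed.

Lemma small_root_unique f g : f 0%N = 0 -> g 0%N = 0 ->
  b * f = c + a * f ^+ 2 -> b * g = c + a * g ^+ 2 -> f = g.
Proof.
move=> f0 g0 rf rg; have ef := small_root_fix f rf; have eg := small_root_fix g rg.
apply/funext => n.
suff: forall m, eqps m f g by move=> /(_ n.+1); exact.
by elim=> [//|m IH]; rewrite ef eg; exact: Phi_contract.
Qed.

Lemma small_root_exists : exists f : pser, f 0%N = 0 /\ b * f = c + a * f ^+ 2.
Proof.
pose it m := iter m Phi 0.
have it0 m : it m 0%N = 0 by elim: m => [|m IH] //; exact: Phi0.
have itS m l : eqps m (it m) (it (m + l)%N).
  elim: m => [//|m IH]; rewrite addSn; exact: Phi_contract.
pose f : pser := fun n => it n.+1 n.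
have fit m : eqps m f (it m).
  by move=> i lt_im; rewrite /f (itS i.+1 (m - i.+1)%N) // subnKC.
have f0 : f 0%N = 0 := it0 1%N.
exists f; split=> //.
have ef : f = Phi f.
  apply/funext => n; rewrite (fit n.+1) //.
  by have /(_ n (ltnSn n)) -> := Phi_contract _ _ _ f0 (it0 n) (fit n).
have : f + (1 + b) * f = c + a * f ^+ 2 by rewrite {1}ef /Phi -addrA addss addr0.
by move=> <-; psring2.
Qed.

End SmallRoot.

(** If [x = 1/xi] is a root of [a x^2 + b x + a'], substituting [x = A + eta] gives the equation of
    [eta]; the reversals only divide by powers of [t]. *)
Lemma cf_step (d D : nat) (a a' b A : {poly F2}) (xi eta : pser) :
  (size a <= D.+1)%N -> (size a' <= D.+1)%N -> (size b <= D.+1)%N -> (size A <= d.+1)%N ->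
  (0 < d)%N -> A`_d = 1 -> b`_D = 1 -> xi 0%N = 0 ->
  (size (a * A ^+ 2 + b * A + a')%R <= D.+1)%N ->
  ofp (revp D b) * xi = ofp (revp D a) + ofp (revp D a') * xi ^+ 2 ->
  ofp (revp D b) * eta = ofp (revp D (a * A ^+ 2 + b * A + a')) + ofp (revp D a) * eta ^+ 2 ->
  xi * (ofp (revp d A) + ofp 'X^d * eta) = ofp 'X^d.
Proof.
move=> sa sa' sb sA d0 Ad bD xi0 sa2; set a2 := a * _ + _ + _ => e1 e2.
set u := ofp (revp d A) + ofp 'X^d * eta.
have Xd0 f : (ofp 'X^d * f) 0%N = 0 by rewrite coef_psXnM d0.
have u0 : u 0%N = 1 by rewrite /u coef_psD Xd0 addr0 /ofp coef_rev subn0.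
have b0 : (ofp (revp D b) * u) 0%N = 1.
  by rewrite coef_psM0 u0 /ofp coef_rev subn0 bD mulr1.
have ea : revp D a * revp d A ^+ 2 + revp D b * revp d A * 'X^d + revp D a' * 'X^d * 'X^d
    + revp D a2 * 'X^d * 'X^d = 0.
  rewrite -(rev_exp _ _ 2 sA) -revM //; last first.
    by apply: leq_trans (size_poly_exp_leq _ _) _; rewrite ltnS leq_mul2r;
      case: size sA => [|k] /=; lia.
  rewrite -(revM _ _ _ _ sb sA) -rev_addn; last first.
    by apply: leq_trans (size_polyMleq _ _) _; lia.
  rewrite -!mulrA -!exprD -!rev_addn // -addnA addnn -muln2 -!linearD /=.
  by rewrite -/a2 addpp linear0.
apply: addsC_eq.
(* Up to reversal, the difference [f] of the two sides satisfies [b u f = a' f^2], whose only root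
   without constant term is [0]. *)
apply: (@small_root_unique (ofp (revp D a')) (ofp (revp D b) * u) 0) => //.
- by rewrite coef_psD coef_psM0 xi0 mul0r /ofp coefXn add0r; case: (d) d0.
- have := congr1 ofp ea; rewrite !ofpD !ofpM ofp0 -/(ofp 'X^d) => ea'.
  rewrite add0r.
  apply: addsC_eq.
  have -> : ofp (revp D b) * u * (xi * u + ofp 'X^d) + ofp (revp D a') * (xi * u + ofp 'X^d) ^+ 2
    = u ^+ 2 * (ofp (revp D b) * xi) + ofp (revp D b) * u * ofp 'X^d
      + ofp (revp D a') * (xi * u) ^+ 2 + ofp (revp D a') * ofp 'X^d * ofp 'X^d by psring2.
  rewrite e1.
  have -> : u ^+ 2 * (ofp (revp D a) + ofp (revp D a') * xi ^+ 2) + ofp (revp D b) * u * ofp 'X^d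
      + ofp (revp D a') * (xi * u) ^+ 2 + ofp (revp D a') * ofp 'X^d * ofp 'X^d
    = ofp (revp D a) * u ^+ 2 + ofp (revp D b) * u * ofp 'X^d
      + ofp (revp D a') * ofp 'X^d * ofp 'X^d by psring2.
  have -> : ofp (revp D a) * u ^+ 2 + ofp (revp D b) * u * ofp 'X^d
      + ofp (revp D a') * ofp 'X^d * ofp 'X^d
    = (ofp (revp D a) * ofp (revp d A) ^+ 2 + ofp (revp D b) * ofp (revp d A) * ofp 'X^d
       + ofp (revp D a') * ofp 'X^d * ofp 'X^d)
      + ofp 'X^d * ofp 'X^d * (ofp (revp D b) * eta + ofp (revp D a) * eta ^+ 2).
    by rewrite /u; psring2.
  rewrite e2 -[_ + _ + ofp (revp D a) * eta ^+ 2]addrA addss addr0.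
  rewrite -[RHS]ea'; ring.
- by rewrite expr0n !mulr0 addr0.
Qed.

Lemma eqps_unit n f u : u 0%N = 1 -> eqps n (f * u) 0 -> eqps n f 0.
Proof.
move=> u0 fu; suff: forall m, (m <= n)%N -> eqps m f 0 by apply.
elim=> [//|m IH] lt_mn.
have -> : f = f * u + (1 + u) * f by psring2.
rewrite -[0]addr0; apply: eqpsD.
  by move=> i lt_im; apply: fu; exact: leq_trans lt_im lt_mn.
apply: eqps_mul_small (IH (ltnW lt_mn)).
by rewrite coef_psD u0 -[(1 : pser) 0%N]/1 addF2.
Qed.

Lemma eqps_XnM n d f g : eqps (d + n) (ofp 'X^d * f) (ofp 'X^d * g) -> eqps n f g.
Proof.
move=> fg i lt_in; have := fg (d + i)%N; rewrite ltn_add2l !coef_psXnM.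
by rewrite [(_ < d)%N]ltnNge leq_addr addKn /=; apply.
Qed.

Lemma eqps_leq m n f g : (m <= n)%N -> eqps n f g -> eqps m f g.
Proof. by move=> le_mn fg i lt_im; apply: fg; exact: leq_trans le_mn. Qed.

Lemma eqps_trans n f g h : eqps n f g -> eqps n g h -> eqps n f h.
Proof. by move=> fg gh i lt_in; rewrite fg ?gh. Qed.

Lemma eqps_sym n f g : eqps n f g -> eqps n g f.
Proof. by move=> fg i lt_in; rewrite fg. Qed.

Lemma low_coef0 d (p : {poly F2}) : eqps d (ofp p) 0 -> p = 'X^d * drop_poly d p.
Proof.
move=> p0; rewrite -{1}[p](poly_take_drop d) mulrC (_ : take_poly d p = 0) ?add0r //.
by apply/polyP => i; rewrite coef_take_poly coef0; case: ltnP => // /p0.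
Qed.

(* A Pade approximation [Q * xi = P] of order twice the degree bound descends along the
   continued fraction of [xi] until nothing is left of [Q]. *)
Lemma cf_regular (d : nat -> nat) (xi : nat -> pser) (A : nat -> {poly F2}) :
  (forall i, 0 < d i)%N -> (forall i, size (A i) <= (d i).+1)%N -> (forall i, (A i)`_0 = 1) ->
  (forall i, xi i * (ofp (A i) + ofp 'X^(d i) * xi i.+1) = ofp 'X^(d i)) ->
  forall l i (Q P : {poly F2}) (n := (\sum_(j < l) d (i + j)%N)%N),
    (size Q <= n)%N -> (size P <= n)%N -> eqps n.*2 (ofp Q * xi i) (ofp P) -> Q = 0.
Proof.
move=> d0 sA A0 exi; elim=> [|l IH] i Q P n.
  by rewrite /n big_ord0 leqn0 size_poly_eq0 => /eqP.
pose n' := (\sum_(j < l) d (i.+1 + j)%N)%N.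
have en : n = (d i + n')%N.
  rewrite /n big_ord_recl addn0; congr (_ + _)%N; apply: eq_bigr => j _.
  by rewrite /= /bump add1n addnS.
move: n en => n -> sQ sP QP; set u := ofp (A i) + ofp 'X^(d i) * xi i.+1.
have u0 : u 0%N = 1 by rewrite /u coef_psD coef_psXnM d0 addr0 /ofp.
(* Multiplying [Q xi = P] by [u] gives [P u = 'X^(d i) Q]. So ['X^(d i)] divides [P], and the
   quotient [P'] is the next denominator, with numerator [(Q + P' A) / 'X^(d i)]. *)
have Pu : eqps (d i + (d i + n'.*2)) (ofp P * u) (ofp 'X^(d i) * ofp Q).
  apply: (eqps_leq _ (d i + n').*2); first by lia.
  rewrite -exi -/u; apply: eqps_sym.
  have -> : xi i * u * ofp Q = u * (ofp Q * xi i) by ring.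
  by rewrite [ofp P * u]mulrC; exact: eqps_mull.
have eP : P = 'X^(d i) * drop_poly (d i) P.
  apply: low_coef0; apply: (eqps_unit _ _ u u0) => j lt_j.
  by rewrite Pu ?coef_psXnM ?lt_j // (leq_trans lt_j) // leq_addr.
set P' := drop_poly (d i) P in eP.
have sP' : (size P' <= n')%N by rewrite size_drop_poly; lia.
have P'u : eqps (d i + n'.*2) (ofp P' * u) (ofp Q).
  apply: (eqps_XnM _ (d i)); apply: eqps_trans Pu.
  by rewrite eP ofpM mulrA.
have P'xi : eqps (d i + n'.*2) (ofp 'X^(d i) * (ofp P' * xi i.+1)) (ofp (Q + P' * A i)).
  rewrite ofpD ofpM addrC; apply/eqps_sub.
  have -> : ofp 'X^(d i) * (ofp P' * xi i.+1) + (ofp P' * ofp (A i) + ofp Q)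
    = ofp P' * u + ofp Q by rewrite /u; ring.
  by have [h _] := eqps_sub (d i + n'.*2) (ofp P' * u) (ofp Q); exact: h.
have eQ : Q + P' * A i = 'X^(d i) * drop_poly (d i) (Q + P' * A i).
  apply: low_coef0 => j lt_j.
  by rewrite -P'xi ?coef_psXnM ?lt_j // (leq_trans lt_j) // leq_addr.
have P'0 : P' = 0.
  apply: (IH i.+1 P' (drop_poly (d i) (Q + P' * A i))) => //.
    rewrite size_drop_poly leq_subLR; apply: leq_trans (size_polyD _ _) _.
    rewrite geq_max sQ; apply: leq_trans (size_polyMleq _ _) _.
    by have := sA i; rewrite -/n'; lia.
  by apply: (eqps_XnM _ (d i)); rewrite -ofpM -eQ.
apply/polyP => j; rewrite coef0; case: (ltnP j (d i + n')) => [lt_j|le_j].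
  by rewrite -[Q`_j]/(ofp Q j) -P'u ?P'0 ?ofp0 ?mul0r //; lia.
by rewrite nth_default // (leq_trans sQ).
Qed.

Lemma coef_pdeg (p : {poly F2}) : p != 0 -> p`_(pdeg p) = 1.
Proof.
move=> p0; have := p0; rewrite -lead_coef_eq0 lead_coefE -/(pdeg p).
by case: (F2_cases p`_(pdeg p)) => -> //; rewrite eqxx.
Qed.

(** * Passing from power series to Laurent series in [t] *)

Definition ls_of (A : {poly F2}) (f : pser) : ls :=
  fun j => match j with Posz n => A`_n | Negz m => f m.+1 end.

Lemma cf_expansion_of (A : nat -> {poly F2}) (xi : nat -> pser) :
  (forall i, 0 < pdeg (A i.+1))%N -> (forall i, xi i 0%N = 0) ->
  (forall i, xi i * (ofp (revp (pdeg (A i.+1)) (A i.+1)) + ofp 'X^(pdeg (A i.+1)) * xi i.+1)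
      = ofp 'X^(pdeg (A i.+1))) ->
  cf_expansion (ls_of (A 0%N) (xi 0%N)) A.
Proof.
move=> A_gt0 xi0 exi; exists (fun i => ls_of (A i) (xi i)); split=> // i; split=> [n //|].
set d := pdeg (A i.+1); set u := ofp (revp d (A i.+1)) + ofp 'X^d * xi i.+1.
have d0 : (0 < d)%N := A_gt0 i.
exists d%:Z; split.
  case=> // n lt_dn; split=> //=; rewrite nth_default //.
  by move: lt_dn; rewrite ltz_nat /d /pdeg; case: size.
move=> n; rewrite /ls_mul_coef.
case: (ltrP (2 * d%:Z) n) => [lt_dn|le_nd].
  have -> : nat_trunc (2 * d%:Z - n + 1) = 0%N.
    by case E: (2 * d%:Z - n + 1) => [m|m] //=; lia.
  by rewrite big_ord0; case: eqP => // n0; lia.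
(* The complete quotient is [t^d u], so [t^n] corresponds to the index [d - n] of [xi i * u]; the
   extra factor ['X^d] makes this the natural number [2d - n]. *)
have [T eT] : exists T : nat, 2 * d%:Z - n = T%:Z by exists (absz (2 * d%:Z - n)%R); lia.
have -> : nat_trunc (2 * d%:Z - n + 1) = T.+1 by rewrite eT addrC.
have -> : (n == 0)%:R = (ofp 'X^d * (xi i * u)) T.
  rewrite exi -/d -ofpM -exprD /ofp coefXn.
  by congr ((_ : bool)%:R); apply/eqP/eqP; lia.
rewrite mulrA mulrC coef_psM (reindex_inj rev_ord_inj) /=.
rewrite (reindex_inj rev_ord_inj) /=; apply: eq_bigr => k _.
have le_kT : (k <= T)%N by rewrite -ltnS.
rewrite mulrC; congr (_ * _).
- rewrite /u coef_psD coef_psXnM /ofp coef_rev.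
  case: (ltngtP k d) => [lt_kd|lt_dk|ekd].
  + rewrite addr0 (_ : d%:Z - _ = Posz (d - k)%N) //; lia.
  + rewrite add0r (_ : d%:Z - _ = Negz (k - d).-1) /=; last by lia.
    by rewrite prednK // subn_gt0.
  + rewrite ekd subnn xi0 addr0 (_ : d%:Z - _ = Posz 0) //; lia.
- rewrite coef_psXnM /ls_frac.
  case: (ltnP (T - k) d) => [lt_d|le_d].
    rewrite (_ : (n - _ + _ < 0) = false) //; lia.
  case: (ltngtP (T - k) d) le_d => // [lt_d _|ed _].
    rewrite (_ : (n - _ + _ < 0) = true); last by lia.
    rewrite (_ : n - _ + _ = Negz (T - k - d).-1) /=; last by lia.
    by rewrite prednK // subn_gt0.
  by rewrite ed subnn xi0 (_ : (n - _ + _ < 0) = false) //; lia.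
Qed.

(** * The continued fraction of t^k tau(t) *)

Lemma coef_ps_sqr (f : pser) n : (f ^+ 2) n = if odd n then 0 else f n./2.
Proof.
have -> : (f ^+ 2) n = (pser_trunc n f ^+ 2)`_n.
  by rewrite [f ^+ 2]expr2 [pser_trunc n f ^+ 2]expr2; exact: pser_mul_trunc.
have -> : pser_trunc n f ^+ 2 = pser_trunc n f \Po 'X^2.
  rewrite sqr_polyE comp_polyE; apply: eq_bigr => i _.
  by rewrite -exprM mul2n.
rewrite coef_comp_poly_Xn // dvdn2; case: odd => //=.
by rewrite divn2 coef_trunc // -divn2 leq_div.
Qed.

(** Splitting by parity gives [F = (1 + x) F^2 + O], where [O], the sum of the odd powers of [x], is
    [x / (1 + x)^2]. *)
Lemma tau_series_eq (F : pser := tau) (x := ofp 'X) :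
  (1 + x) ^+ 2 * F = (1 + x) ^+ 3 * F ^+ 2 + x.
Proof.
pose O : pser := fun n => (odd n)%:R.
have xM (f : pser) n : (x * f) n = if n is n'.+1 then f n' else 0.
  by rewrite /x -(expr1 'X) coef_psXnM; case: n => // n; rewrite subn1.
have eF : F = (1 + x) * F ^+ 2 + O.
  rewrite mulrDl mul1r; apply/funext => n; rewrite !coef_psD xM coef_ps_sqr /F /O.
  rewrite -[n in tau n]odd_double_half; case: n => [|n] /=; first by rewrite !addr0.
  rewrite coef_ps_sqr.
  case: (boolP (odd n)) => on /=.
    by rewrite addr0 addr0 add0n tau_double.
  by rewrite add0r add1n tau_doubleS uphalf_half (negbTE on).
have eO : (1 + x) ^+ 2 * O = x.
  rewrite (_ : (1 + x) ^+ 2 * O = O + x * (x * O)); last by psring2.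
  apply/funext => -[|[|n]]; rewrite coef_psD !xM /O /x /ofp coefX //= ?addr0 ?add0r //.
  by rewrite negbK addF2.
by rewrite {1}eF mulrDr eO; ring.
Qed.

Lemma rev_X_add1 : revp 1 ('X + 1) = 'X + 1.
Proof.
apply/polyP => i; rewrite coef_rev !coefD !coefX !coef1.
by case: i => [|[|i]] //=; rewrite addr0 ?add0r.
Qed.

Section CfTau.
Variable k : nat.
Hypothesis k_gt0 : (0 < k)%N.

Let s : {poly F2} := 'X + 1.
Let D := (k + 3)%N.
Let b : {poly F2} := 'X^(k.+1) * s ^+ 2.

Let sz_s2 : size (s ^+ 2) = 3%N.
Proof. by have := size_exp s 2; rewrite size_XD1 mul1n; case: size => [|n] /=;
  [by [] | move=> ->]. Qed.

Let sz_s3 : size (s ^+ 3) = 4%N.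
Proof. by have := size_exp s 3; rewrite size_XD1 mul1n; case: size => [|n] /=;
  [by [] | move=> ->]. Qed.

Let s0 : s != 0.
Proof. by rewrite -size_poly_gt0 size_XD1. Qed.

Let sz_b : size b = D.+1.
Proof. by rewrite /b mulrC size_mulXn ?expf_neq0 // sz_s2 /D; lia. Qed.

Let b_D : b`_D = 1.
Proof.
have b0 : b != 0 by rewrite -size_poly_gt0 sz_b.
by have := coef_pdeg _ b0; rewrite /pdeg sz_b.
Qed.

Let rev_b : revp D b = s ^+ 2.
Proof.
rewrite (_ : D = k.+1 + 2)%N; last by rewrite /D; lia.
rewrite revM ?size_polyXn ?sz_s2 //.
by rewrite rev_Xn // subnn expr0 mul1r (rev_exp 1 _ 2) ?size_XD1 // rev_X_add1.
Qed.

(** The homogenised quadratic equation of [t^k tau(t)], obtained from [tau_series_eq] at [x = t^-1]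
    by clearing denominators. *)
Definition tform (p q : {poly F2}) : {poly F2} :=
  s ^+ 3 * p ^+ 2 + b * p * q + 'X^(k.+1) ^+ 2 * q ^+ 2.

Let s_dvd (r : {poly F2}) : (s %| r) = (r.[1] == 0).
Proof.
rewrite -[r.[1] == 0]/(root r 1) -dvdp_XsubCl; congr (_ %| _).
by rewrite /s -polyCN; congr (_ + _%:P); apply/val_inj.
Qed.

Let s1 : s.[1] = 0.
Proof. by apply/eqP; rewrite -s_dvd. Qed.

Let sqr1 n (r : {poly F2}) (u : {poly F2}) :
  s * u + 'X^n * r ^+ 2 = 0 -> s %| r.
Proof.
move=> /(congr1 (fun p : {poly F2} => p.[1])).
rewrite hornerD (hornerM s) (hornerM 'X^n) s1 mul0r add0r !horner_exp hornerX expr1n mul1r horner0 => /eqP.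
by rewrite expf_eq0 s_dvd.
Qed.

(* [s = t + 1] ramifies in the quadratic extension, which is why the form does not
   represent [0]. *)
Lemma tform_aniso p q : tform p q = 0 -> (s %| p) && (s %| q).
Proof.
rewrite /tform /b -exprM => e.
have dq : s %| q.
  apply: (sqr1 (k.+1 * 2) q (s ^+ 2 * p ^+ 2 + 'X^(k.+1) * s * p * q)).
  by rewrite -[RHS]e; ring.
have /dvdpP[q1 eq1] := dq.
have /dvdpP[q2 eq2] : s %| q1.
  apply: (sqr1 (k.+1 * 2) q1 (p ^+ 2 + 'X^(k.+1) * p * q1)).
  apply: (mulfI (expf_neq0 2 s0)).
  by rewrite mulr0 -[RHS]e eq1; ring.
rewrite dq andbT; apply: (sqr1 0 p ('X^(k.+1) * p * q2 + 'X^(k.+1 * 2) * q2 ^+ 2)).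
apply: (mulfI (expf_neq0 3 s0)).
by rewrite mulr0 -[RHS]e eq1 eq2; ring.
Qed.

(** The two roots of a reduced state add up to [b / st.2] and the conjugate root has negative
    degree, so [b %/ st.2] is the polynomial part of the complete quotient. *)
Definition tstep (st : {poly F2} * {poly F2}) :=
  (st.2, st.2 * (b %/ st.2) ^+ 2 + b * (b %/ st.2) + st.1).

(* [p, q] and [p', q'] are consecutive convergents [p/q], [p'/q']; the complete quotient is
   a root of [st.2 x^2 + b x + st.1], whose middle coefficient never changes in
   characteristic 2. *)
Definition treduced (st : {poly F2} * {poly F2}) :=
  [/\ (size st.1 <= D)%N, (size st.2 <= D)%N &
    exists p q p' q', [/\ st.2 = tform p q, st.1 = tform p' q' & p * q' + p' * q = 1]].

Lemma treduced_neq0 st : treduced st -> st.2 != 0.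
Proof.
case=> _ _ [p [q [p' [q' [e2 _ det]]]]]; apply/eqP; rewrite e2 => /tform_aniso/andP[sp sq].
have : s %| 1 by rewrite -det dvdp_add // ?(dvdp_mulr _ sp) ?(dvdp_mull _ sq).
by rewrite dvdp1 size_XD1.
Qed.

Lemma size_tquo st : treduced st ->
  size (b %/ st.2) = (D.+2 - size st.2)%N /\ (0 < size st.2)%N.
Proof.
move=> rst; have a0 := treduced_neq0 _ rst.
have sa : (0 < size st.2)%N by rewrite size_poly_gt0.
by rewrite size_divp // sz_b; split=> //; case: size sa => // n _; rewrite subSS.
Qed.

Lemma treduced_step st : treduced st -> treduced (tstep st).
Proof.
move=> rst; have a0 := treduced_neq0 _ rst; have [sA sa] := size_tquo _ rst.
case: rst => sz1 sz2 [p [q [p' [q' [e2 e1 det]]]]]; split=> //=.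
  (* In characteristic 2 this is the quotient times the remainder, so the degree stays below [D]. *)
  have -> : st.2 * (b %/ st.2) ^+ 2 + b * (b %/ st.2) = b %/ st.2 * (b %% st.2).
    rewrite {2}(divp_eq b st.2); ring2.
  apply: leq_trans (size_polyD _ _) _; rewrite geq_max sz1 andbT.
  apply: leq_trans (size_polyMleq _ _) _.
  rewrite sA; move: (ltn_modpN0 b a0) sa sz2.
  by move: (size st.2) (size (b %% st.2)%R) (D) => x y z; lia.
exists (b %/ st.2 * p + p'), (b %/ st.2 * q + q'), p, q; split=> //.
  move: (b %/ st.2) => A; rewrite e2 e1.
  rewrite -[b * A]mulr1 -det /tform; ring2.
by rewrite -det; ring2.
Qed.

Let A0 := revp k (\poly_(i < k.+1) tau i).
Let a1 := tform A0 1.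
Let xi0 : pser := fun n => if n is n'.+1 then tau (k + n) else 0.

Let tau_split : (tau : pser) = ofp (\poly_(i < k.+1) tau i) + ofp 'X^k * xi0.
Proof.
apply/funext => n; rewrite coef_psD coef_psXnM /ofp coef_poly ltnS.
case: (ltngtP n k) => [lt_nk|lt_kn|->]; first by rewrite addr0.
  rewrite add0r /xi0; have le_kn := ltnW lt_kn; move: (subnKC le_kn) lt_kn.
  by case: (n - k)%N => [|m] <- //; rewrite addn0 ltnn.
by rewrite subnn addr0.
Qed.

Let rev_s n : revp n (s ^+ n) = s ^+ n.
Proof. by have := rev_exp 1 s n; rewrite mul1n size_XD1 rev_X_add1; apply. Qed.

Let size_A0 : (size A0 <= k.+1)%N. Proof. exact: size_rev. Qed.

Let rev_A0 : revp k A0 = \poly_(i < k.+1) tau i.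
Proof. by rewrite revK // size_poly. Qed.

(** Substituting [A0 = t^k tau + xi0] in the quadratic equation leaves [a1 = b xi0 + s^3 xi0^2];
    this shows below that [a1] has degree less than [D]. *)
Let rev_a1 : ofp (revp (D + k) a1) =
  ofp 'X^k * (ofp (s ^+ 2) * xi0 + ofp 'X^k * ofp (s ^+ 3) * xi0 ^+ 2).
Proof.
have e1 : revp (D + k) (s ^+ 3 * A0 ^+ 2) = s ^+ 3 * (revp k A0) ^+ 2.
  rewrite (_ : D + k = 3 + k * 2)%N; last by rewrite /D; lia.
  rewrite revM ?sz_s3 // ?rev_exp ?rev_s // (leq_trans (size_poly_exp_leq _ _)) //.
  by rewrite ltnS leq_mul2r; move: size_A0; case: size => [|n] /=; lia.
have e2 : revp (D + k) (b * A0) = s ^+ 2 * revp k A0.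
  by rewrite revM ?sz_b // rev_b.
have e3 : revp (D + k) ('X^(k.+1) ^+ 2) = 'X.
  rewrite -exprM rev_Xn; last by rewrite /D; lia.
  by rewrite (_ : _ - _ = 1)%N // /D; lia.
rewrite /a1 /tform !mulr1 expr1n mulr1 !linearD /= e1 e2 e3 rev_A0.
have es : 1 + ofp 'X = ofp s by rewrite /s ofpD ofp1 addrC.
have te : ofp s ^+ 2 * tau = ofp s ^+ 3 * (tau : pser) ^+ 2 + ofp 'X.
  by rewrite -es; exact: tau_series_eq.
rewrite !ofpD (ofpM (s ^+ 3)) (ofpM (s ^+ 2)) !(ofp_exp _ 2) !(ofp_exp _ 3).
rewrite tau_split in te; move: te.
move: (ofp (\poly_(i < k.+1) tau i)) (ofp 'X^k) (ofp s) (ofp 'X) => t z y x te.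
apply: addsC_eq.
rewrite -[RHS](addss (y ^+ 2 * (t + z * xi0))) {2}te; psring2.
Qed.

Let xi0_0 : xi0 0%N = 0. Proof. by []. Qed.

Let size_a1 : (size a1 <= D)%N.
Proof.
have sz : (size a1 <= (D + k).+1)%N.
  have le3 (p q r : {poly F2}) n : (size p <= n)%N -> (size q <= n)%N -> (size r <= n)%N ->
      (size (p + q + r)%R <= n)%N.
    move=> sp sq sr; apply: leq_trans (size_polyD _ _) _; rewrite geq_max sr andbT.
    by apply: leq_trans (size_polyD _ _) _; rewrite geq_max sp sq.
  rewrite /a1 /tform !mulr1 expr1n mulr1; apply: le3.
  - apply: leq_trans (size_polyMleq _ _) _; rewrite sz_s3.
    have : (size (A0 ^+ 2) <= (k * 2).+1)%N.
      apply: leq_trans (size_poly_exp_leq _ _) _; rewrite ltnS leq_mul2r.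
      by move: size_A0; case: size => [|n] /=; lia.
    by rewrite /D; move: (size (A0 ^+ 2)) => x; lia.
  - apply: leq_trans (size_polyMleq _ _) _; rewrite sz_b; move: size_A0.
    by move: (size A0) (D) => x y; lia.
  - by rewrite -exprM size_polyXn /D; lia.
apply/leq_sizeP => j le_Dj.
rewrite -(revK _ _ sz) coef_rev; case: leqP => // le_j.
rewrite -[_`_(D + k - j)]/(ofp (revp (D + k) a1) (D + k - j)%N) rev_a1 coef_psXnM.
case: ltnP => // lt_k.
have -> : (D + k - j - k = 0)%N by move: (D) le_Dj lt_k => x; lia.
by rewrite coef_psD [xi0 ^+ 2]expr2 !coef_psM0 xi0_0 !mulr0 addr0.
Qed.

Let root_xi0 :
  ofp (revp D b) * xi0 = ofp (revp D a1) + ofp (revp D (s ^+ 3)) * xi0 ^+ 2.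
Proof.
have -> : revp D (s ^+ 3) = s ^+ 3 * 'X^k.
  by rewrite /D addnC rev_addn ?sz_s3 // rev_s.
have := rev_a1; rewrite rev_addn ?(leqW size_a1) // ofpM mulrC => e.
have {}e : ofp (revp D a1) = ofp (s ^+ 2) * xi0 + ofp 'X^k * ofp (s ^+ 3) * xi0 ^+ 2.
  apply/funext => n; apply: (eqps_XnM n.+1 k) (ltnSn n) => i _.
  by rewrite e.
by rewrite rev_b e ofpM [ofp _ * ofp 'X^k]mulrC -addrA addss addr0.
Qed.

Let state n := iter n tstep (s ^+ 3, a1).

Let state_reduced n : treduced (state n).
Proof.
elim: n => [|n IH]; last exact: treduced_step.
(* The size [4] of [s ^+ 3] must not exceed [D = k + 3], whence [0 < k]. *)
split=> //=; first by rewrite sz_s3 /D; move: k_gt0; lia.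
exists A0, 1, 1, 0; split=> //.
  by rewrite /tform expr1n expr0n !mulr0 !addr0 mulr1.
by rewrite mulr0 add0r mulr1.
Qed.

Definition tau_cf (i : nat) : {poly F2} := if i is i'.+1 then b %/ (state i').2 else A0.

Lemma pdeg_tau_cf i : (0 < pdeg (tau_cf i.+1))%N.
Proof.
have [sA sa] := size_tquo _ (state_reduced i).
have [_ sz _] := state_reduced i.
by rewrite /pdeg /= sA; move: (size _) sz sa => x; move: (D) => y; lia.
Qed.

(** Pigeonhole: reduced states have bounded degree over a finite field, and each determines the
    next. The index [i.+1] reads state [i], hence the preperiod [m.+1]. *)
Lemma tau_cf_periodic : exists i0 l, (0 < l)%N /\
  forall i, (i0 <= i)%N -> tau_cf (i + l) = tau_cf i.
Proof.
pose enc n : 'rV[F2]_D * 'rV[F2]_D := (poly_rV (state n).1, poly_rV (state n).2).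
have enc_inj m n : enc m = enc n -> state m = state n.
  case=> /(congr1 rVpoly) e1 /(congr1 rVpoly) e2; move: e1 e2.
  have [sm1 sm2 _] := state_reduced m; have [sn1 sn2 _] := state_reduced n.
  rewrite !poly_rV_K //; case: (state m) (state n) => [? ?] [? ?] /= -> -> //.
have [m [n [lt_mn eq_mn]]] : exists m n, (m < n)%N /\ state m = state n.
  pose N := #|{: 'rV[F2]_D * 'rV[F2]_D}|.
  have /injectivePn[x [y neq_xy exy]] : ~~ injectiveb (fun i : 'I_N.+1 => enc i).
    apply/negP => /injectiveP /leq_card; rewrite card_ord; by rewrite ltnn.
  have {}exy := enc_inj _ _ exy.
  by case: (ltngtP x y) (neq_xy) => [lt|lt|e]; [exists x, y | exists y, x | case/eqP;
    exact: val_inj].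
exists m.+1, (n - m)%N; split; first by rewrite subn_gt0.
case=> // i le_mi; rewrite addSn /=; congr (_ %/ (_).2).
rewrite -(subnK (le_mi : m <= i)%N) -addnA subnKC ?(ltnW lt_mn) //.
by rewrite /state !iterD -!/(state _) eq_mn.
Qed.

Lemma ls_of_tau : ls_of A0 xi0 = ls_mul_tpow tau_series k.
Proof.
apply/funext => -[n|m]; rewrite /ls_of /ls_mul_tpow.
  rewrite /A0 coef_rev; case: (ltngtP n k) => [lt_nk|lt_kn|->].
  - rewrite coef_poly ltnS leq_subr (_ : Posz n - _ = Negz (k - n).-1); last by lia.
    by rewrite /tau_series prednK // subn_gt0.
  - by rewrite (_ : Posz n - _ = Posz (n - k)%N) //; lia.
  - by rewrite subnn coef_poly tau0 subrr.
rewrite (_ : Negz m - _ = Negz (k + m)) /=; last by lia.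
by rewrite /tau addnS.
Qed.

(** The fractional parts are chosen as small roots of the successive equations; uniqueness
    identifies the first with [xi0], and [cf_step] links consecutive ones. *)
Lemma tau_cf_roots : exists xi : nat -> pser, [/\ xi 0%N = xi0, forall i, xi i 0%N = 0 &
  forall i (d := pdeg (tau_cf i.+1)),
    xi i * (ofp (revp d (tau_cf i.+1)) + ofp 'X^d * xi i.+1) = ofp 'X^d].
Proof.
have b0 : ofp (revp D b) 0%N = 1 by rewrite /ofp coef_rev subn0 b_D.
have st0 n : ofp (revp D (state n).2) 0%N = 0.
  have [_ sz _] := state_reduced n.
  by rewrite /ofp coef_rev subn0 nth_default.
pose isroot n (f : pser) := f 0%N = 0 /\
  ofp (revp D b) * f = ofp (revp D (state n).2) + ofp (revp D (state n).1) * f ^+ 2.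
have [xi xiP] : exists xi : nat -> pser, forall n, isroot n (xi n).
  have [n|xi xiP] := choice (P := isroot).
    by have [f [f0 ef]] := small_root_exists (ofp (revp D (state n).1)) _ _ b0 (st0 n);
      exists f.
  by exists xi.
exists xi; split.
- have [x0 ex] := xiP 0%N.
  exact: (small_root_unique _ _ _ b0 _ _ x0 xi0_0 ex root_xi0).
- by move=> i; have [] := xiP i.
- move=> i d; have [x0 ex] := xiP i; have [x1 ex1] := xiP i.+1.
  have [sz1 sz2 _] := state_reduced i; have [_ sz3 _] := state_reduced i.+1.
  have d0 : (0 < d)%N := pdeg_tau_cf i.
  have A_neq0 : tau_cf i.+1 != 0.
    by apply: contraTneq d0 => e; rewrite /d e /pdeg size_poly0.
  apply: (cf_step d D (state i).2 (state i).1 b _ _ _) => //.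
  + exact: leqW.
  + exact: leqW.
  + by rewrite sz_b.
  + by rewrite /d /pdeg prednK // size_poly_gt0.
  + exact: coef_pdeg.
  + exact: leqW.
Qed.

End CfTau.

(** * Generic escape of mass *)

Lemma Lam_mulXn m (p : {poly F2}) n : (size p <= n)%N ->
  Lam ('X^m * p) = \sum_(j < n) p`_j * tau (m + j).
Proof.
move=> sp; transitivity (lext (fun j => tau (m + j) : F2^o) p); last exact: lextE.
rewrite /Lam; elim: m (tau : nat -> F2^o) => [|m IH] f; first by rewrite mul1r; exact: eq_lext.
by rewrite exprS -mulrA lext_mulX IH; exact: eq_lext.
Qed.

(** The sum is the degree of a convergent denominator. A witness of singularity, reversed, would be
    a Pade approximation forbidden by [cf_regular]. *)
Lemma regular_tau_cf k l : (0 < k)%N ->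
  regular k (\sum_(j < l) pdeg (tau_cf k j.+1))%N.
Proof.
move=> k0; apply/asboolPn => -[q [q0 sq Lq]].
pose d j := pdeg (tau_cf k j.+1); set n := (\sum_(j < l) _)%N in sq Lq.
have [xi [xi_0 xi0 exi]] := tau_cf_roots k k0.
have n0 : (0 < n)%N by apply: leq_trans sq; rewrite size_poly_gt0.
have eq_sum : (\sum_(j < l) d (0 + j)%N)%N = n by apply: eq_bigr.
have sA i : (size (revp (d i) (tau_cf k i.+1)) <= (d i).+1)%N by exact: size_rev.
have A0 i : (revp (d i) (tau_cf k i.+1))`_0 = 1.
  rewrite coef_rev subn0 coef_pdeg //; apply: contraTneq (pdeg_tau_cf k k0 i) => ->.
  by rewrite /pdeg size_poly0.
have sq' : (size q <= n.-1.+1)%N by rewrite prednK.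
pose P := \poly_(i < n) (ofp (revp n.-1 q) * xi 0%N) i.
have rq : eqps n.*2 (ofp (revp n.-1 q) * xi 0%N) (ofp P) -> revp n.-1 q = 0.
  have := cf_regular d xi _ (pdeg_tau_cf k k0) sA A0 exi l 0 (revp n.-1 q) P.
  rewrite eq_sum => H; apply: H; last exact: size_poly.
  by apply: leq_trans (size_rev _ _) _; rewrite prednK.
suff rev0 : revp n.-1 q = 0 by move: q0; rewrite -(revK _ _ sq') rev0 linear0 eqxx.
(* Below order [n] the agreement is the definition of [P]; order [n + r] is the equation [Lq r]. *)
apply: rq => i lt_i; rewrite [RHS]coef_poly; case: ltnP => // le_ni.
rewrite -(subnKC le_ni); set r := (i - n)%N.
have lt_r : (r < n)%N by rewrite /r; lia.
rewrite coef_psM -addnS big_split_ord /= [X in _ + X]big1 ?addr0; last first.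
  move=> j _; rewrite /ofp coef_rev leqNgt (_ : (n.-1 < n + j)%N) ?mul0r //.
  by rewrite prednK // leq_addr.
rewrite -[RHS](Lq r lt_r) (Lam_mulXn _ _ n) // (reindex_inj rev_ord_inj) /=.
apply: eq_bigr => j _; rewrite /ofp coef_rev xi_0.
have lt_j := ltn_ord j.
have -> : (n - j.+1 <= n.-1)%N by lia.
have -> : (n.-1 - (n - j.+1) = j)%N by lia.
have -> : (n + r - (n - j.+1) = (r + j).+1)%N by lia.
by congr (_ * tau _); lia.
Qed.

Lemma regular_count_leq k X Y : (X <= Y)%N -> (regular_count k X <= regular_count k Y)%N.
Proof.
by move=> /subnKC <-; rewrite /regular_count big_split_ord /= leq_addr.
Qed.

Lemma regular_count_sum k (d : nat -> nat) N : (forall i, 0 < d i)%N ->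
  (forall l, regular k (\sum_(j < l) d j)%N) -> (N <= regular_count k (\sum_(j < N) d j)%N)%N.
Proof.
move=> d0 reg; elim: N => [//|N IH]; rewrite big_ord_recr /=.
apply: leq_trans (regular_count_leq _ (\sum_(j < N) d j).+1%N _ _); last first.
  by rewrite -addn1 leq_add2l.
by rewrite /regular_count big_ord_recr /= reg addn1 ltnS.
Qed.

Lemma regular_count_dense k (d : nat -> nat) i0 l C :
  (forall i, 0 < d i)%N -> (forall N, regular k (\sum_(j < N) d j)%N) -> (0 < l)%N ->
  (forall i, (i0 <= i)%N -> d (i + l)%N = d i) -> (\sum_(j < l) d (i0 + j)%N <= C * l)%N ->
  exists X0, forall X, (X0 <= X)%N -> (X <= 2 * C * regular_count k X)%N.
Proof.
move=> d0 reg l0 per; set D := (\sum_(j < l) _)%N => leDC.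
have D0 : (0 < D)%N.
  by rewrite /D; case: (l) l0 => // l' _; rewrite big_ord_recl addn_gt0 d0.
pose n := (\sum_(j < i0) d j)%N.
have sum_per c : (\sum_(j < i0 + c * l) d j = n + c * D)%N.
  rewrite big_split_ord /=; congr (_ + _)%N; rewrite (sum_ord_mul (fun j => d (i0 + j)%N)).
  rewrite -[c in RHS]card_ord -sum_nat_const; apply: eq_bigr => i _; apply: eq_bigr => j _.
  elim: (nat_of_ord i) => [|x IH]; first by rewrite muln0.
  by rewrite -IH mulnS -[RHS]per ?leq_addr //; congr d; lia.
(* From here on, the preperiod and the incomplete last period fill at most half of [X], which costs
   the factor [2]. *)
clearbody n D; exists (2 * (n + D))%N => X le_X.
pose c := ((X - n) %/ D)%N.
have le_c : (n + c * D <= X)%N.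
  have := leq_trunc_div (X - n) D; rewrite -/c; lia.
have lt_c : (X - n < c * D + D)%N.
  by rewrite -mulSnr ltn_ceil.
have cnt : (c * l <= regular_count k X)%N.
  apply: leq_trans (regular_count_leq _ _ _ le_c).
  rewrite -sum_per; apply: leq_trans (regular_count_sum _ _ _ d0 reg); exact: leq_addl.
apply: (@leq_trans (2 * C * (c * l))); last by rewrite leq_mul2l cnt orbT.
apply: (@leq_trans (2 * (c * D))); first by lia.
by rewrite -mulnA leq_mul2l /= mulnCA leq_mul2l leDC orbT.
Qed.

(** Over a period, cutting at [n] loses at most [l * n], less than [eps] times the total degree as
    soon as the mean degree exceeds [C > n / eps]. Failure thus bounds the mean degree by [C]. *)
Lemma escape_fail_dense (R : realType) (eps : R) n : 0 < eps ->
  exists c, forall k, (0 < k)%N -> ~ escape_set tau_series n eps k ->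
    exists X0, forall X, (X0 <= X)%N -> (X <= c * regular_count k X)%N.
Proof.
move=> eps0; pose C := (Num.truncn (n%:R / eps)).+1; exists (2 * C)%N => k k0 fail.
have [i0 [l [l0 per]]] := tau_cf_periodic k k0.
pose d j := pdeg (tau_cf k j.+1).
have perS i : (i0 <= i)%N -> tau_cf k (i.+1 + l) = tau_cf k i.+1.
  by move=> le_i; apply: per; exact: leqW.
apply: (regular_count_dense k d i0 l C) => //.
- exact: pdeg_tau_cf.
- by move=> N; exact: regular_tau_cf.
- by move=> i le_i; rewrite /d -addSn perS.
rewrite leqNgt; apply/negP => lt_Cl; apply: fail; exists (tau_cf k), i0.+1, l; split.
  split; last by split=> // i le_i; apply: per; exact: ltnW.
  have [xi [xi_0 xi0 exi]] := tau_cf_roots k k0.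
  by have := cf_expansion_of (tau_cf k) xi (pdeg_tau_cf k k0) xi0 exi; rewrite xi_0 ls_of_tau.
rewrite /escape_ratio.
set E := (\sum_(j < l) _)%N; set D := (\sum_(j < l) _)%N.
have eD : D = (\sum_(j < l) d (i0 + j)%N)%N by apply: eq_bigr => j _; rewrite /d addSn.
rewrite -eD in lt_Cl.
have D0 : (0 < D%:R :> R) by rewrite ltr0n; exact: leq_ltn_trans lt_Cl.
have le_DE : (D <= E + l * n)%N.
  rewrite (_ : l * n = \sum_(j < l) n)%N; last by rewrite sum_nat_const card_ord.
  rewrite -big_split /=.
  by apply: leq_sum => j _; move: (pdeg _) => p; lia.
rewrite ltr_pdivlMr // mulrBl mul1r ltrBlDr.
have le_DE' : D%:R <= E%:R + l%:R * n%:R :> R by rewrite -natrM -natrD ler_nat.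
apply: le_lt_trans le_DE' _; rewrite ltrD2l.
have lt1 : n%:R < eps * C%:R.
  by rewrite mulrC -ltr_pdivrMr //; exact: truncnS_gt.
have lt2 : C%:R * l%:R < D%:R :> R by rewrite -natrM ltr_nat.
apply: (@lt_trans _ _ (eps * (C%:R * l%:R))); last by rewrite ltr_pM2l.
by rewrite mulrA [ltLHS]mulrC ltr_pM2r // ltr0n.
Qed.

(** In [dense_columns_count], first fix [h] so that the main term is below [e / 2 * m], then take
    [m] large enough to absorb the constant [K] of the last block. *)
Lemma density_one (R : realType) (S : nat -> Prop) c :
  (forall k, (0 < k)%N -> ~ S k ->
    exists X0, forall X, (X0 <= X)%N -> (X <= c * regular_count k X)%N) ->
  has_density S (1 : R).
Proof.
move=> dense; pose bad k : bool := (0 < k)%N && `[< ~ S k >].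
have bad_dense k : bad k -> exists X0, forall X, (X0 <= X)%N -> (X <= c * regular_count k X)%N.
  by case/andP=> k0 /asboolP; exact: dense.
pose B m := (\sum_(1 <= k < m.+1) bad k)%N.
have eB m : (\sum_(1 <= k < m.+1) (`[< S k >] : nat) + B m = m)%N.
  rewrite -big_split /= -[RHS](subn0 m) -[RHS]subSS -[RHS]muln1 -sum_nat_const_nat.
  apply: eq_big_nat => k /andP[k0 _]; rewrite /bad k0 /= asbool_neg.
  by case: `[< S k >].
apply/cvgrPdist_lt => e e0.
pose a : R := 255%:R / 256%:R.
have a0 : 0 <= a := divr_ge0 (ler0n _ _) (ler0n _ _).
have a1 : `|a| < 1.
  by rewrite ger0_norm // ltr_pdivrMr ?ltr0n // mul1r ltr_nat.
have [h lt_h] : exists h : nat, c%:R * a ^+ h < e / 2 :> R.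
  have cv : c%:R * a ^+ h @[h --> \oo] --> c%:R * (0 : R).
    by apply: cvgMr; exact: cvg_expr.
  move/cvgrPdist_lt: cv => /(_ (e / 2)); rewrite divr_gt0 // => /(_ isT) [h _ hP].
  exists h; have := hP h (leqnn h); rewrite mulr0 sub0r normrN ger0_norm //.
  by rewrite mulr_ge0 // exprn_ge0.
pose K := (c * 255 ^ h)%N.
near=> m.
have m0 : (0 < m)%N by near: m; exact: nbhs_infty_gt.
have mR : 0 < m%:R :> R by rewrite ltr0n.
have -> : 1 - density_ratio R S m = (B m)%:R / m%:R.
  apply: (mulIf (lt0r_neq0 mR)); rewrite mulrBl mul1r !divfK ?lt0r_neq0 //.
  by apply/eqP; rewrite subr_eq -natrD addnC eB.
rewrite ger0_norm ?divr_ge0 // ltr_pdivrMr //.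
have w0 : 0 < (16 ^ h)%:R :> R by rewrite ltr0n expn_gt0.
have cnt := dense_columns_count bad c h m bad_dense.
rewrite -big_distrl /= -/(B m) -/K in cnt.
have cntR : (B m)%:R * (16 ^ h)%:R <= (m%:R / (16 ^ h)%:R + 1) * K%:R :> R.
  rewrite -natrM; apply: le_trans (_ : ((m %/ 16 ^ h).+1 * K)%:R <= _);
    first by rewrite ler_nat.
  rewrite natrM ler_wpM2r // -natr1 lerD2r ler_pdivlMr // -natrM ler_nat.
  exact: leq_trunc_div.
have lt_K : K%:R < e / 2 * m%:R :> R.
  rewrite mulrC -ltr_pdivrMr ?divr_gt0 //.
  have lt_m : (Num.truncn (K%:R / (e / 2)) < m)%N by near: m; exact: nbhs_infty_gt.
  by apply: lt_le_trans (truncnS_gt _) _; rewrite ler_nat.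
have eK : K%:R = c%:R * a ^+ h * ((16 ^ h)%:R * (16 ^ h)%:R) :> R.
  rewrite /a expr_div_n -(natrM _ (16 ^ h)) -expnMn natrM !natrX -mulrA.
  by rewrite divfK // expf_neq0 // pnatr_eq0.
have le_w : 1 <= (16 ^ h)%:R :> R by rewrite ler1n expn_gt0.
rewrite -(ltr_pM2r w0); apply: le_lt_trans cntR _.
rewrite mulrDl mul1r.
have -> : m%:R / (16 ^ h)%:R * K%:R =
    c%:R * a ^+ h * m%:R * (16 ^ h)%:R :> R.
  by rewrite eK; field; rewrite ?lt0r_neq0.
have e1 : c%:R * a ^+ h * m%:R * (16 ^ h)%:R < e / 2 * m%:R * (16 ^ h)%:R.
  by rewrite !ltr_pM2r.
have e2 : K%:R < e / 2 * m%:R * (16 ^ h)%:R.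
  apply: lt_le_trans lt_K _; rewrite ler_peMr // mulr_ge0 // divr_ge0 //; exact: ltW.
apply: lt_le_trans (ltrD e1 e2) _.
by rewrite {3}(splitr e) !mulrDl.
Unshelve. all: by end_near.
Qed.

Theorem theorem1p31 (R : realType) (eps : R) : 0 < eps ->
  exists d : nat -> R,
    (\forall n \near \oo, has_density (escape_set tau_series n eps) (d n)) /\
    d n @[n --> \oo] --> (1 : R).
Proof.
move=> eps0; exists (fun=> 1); split; last exact: cvg_cst.
apply: nearW => n; have [c dense] := @escape_fail_dense R eps n eps0.
exact: density_one dense.
Qed.
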